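(* Let $f$ and $g$ be transcendental entire functions with $f\circ g=g\circ f$, where $f\in\mathcal{B}$ and $g(z)=a f^{p}(z)+b$ for all $z\in\mathbb{C}$, with $a,b\in\mathbb{C}$, $p\in\mathbb{N}$, $a\neq 0,1$ and $|a|=1$. If $f$ is postsingularly finite, then $g$ and $f\circ g$ are postsingularly finite.
   Context: $\mathbb{N}=\{1,2,\dots\}$; $f^{n}$ denotes the $n$-th iterate of $f$ (with $f^0$ the identity). For a transcendental entire function $f:\mathbb{C}\to\mathbb{C}$: a critical value is a point $w\in\mathbb{C}$ such that $w=f(w_0)$ for some $w_0\in\mathbb{C}$ with $f'(w_0)=0$; an asymptotic value is a point $\zeta\in\mathbb{C}$ such that there is a curve $\Gamma$ tending to infinity with $f(z)\to\zeta$ as $z\to\infty$ along $\Gamma$. $\mathrm{Sing}(f^{-1})$ is the set of all critical values and asymptotic values of $f$ together with their finite limit points. $\mathcal{B}$ is the class of transcendental entire functions $f$ for which $\mathrm{Sing}(f^{-1})$ is bounded. The postsingular set of $f$ is $P(f)=\overline{\bigcup_{n\ge 0} f^{n}(\mathrm{Sing}(f^{-1}))}$ (closure in $\mathbb{C}$). $f$ is called postsingularly finite if $P(f)$ is a finite set. *)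

(* Defs.v *)
From Stdlib Require Import Reals List.
From Coquelicot Require Import Coquelicot.

Local Open Scope C_scope.

(* Derivatives are taken over the field C: complex differentiability. *)
Definition entire (f : C -> C) : Prop :=
  forall z : C, @ex_derive C_AbsRing C_NormedModule f z.

Definition polynomial (f : C -> C) : Prop :=
  exists (n : nat) (c : nat -> C),
    forall z : C, f z = sum_n (fun k => c k * z ^ k) n.

Definition transcendental_entire (f : C -> C) : Prop :=
  entire f /\ ~ polynomial f.

Definition closure (S : C -> Prop) (z : C) : Prop :=
  forall U : C -> Prop, locally z U -> exists w : C, U w /\ S w.

Definition limit_point (S : C -> Prop) (z : C) : Prop :=
  forall U : C -> Prop, locally z U -> exists w : C, U w /\ w <> z /\ S w.

Definition bounded_set (S : C -> Prop) : Prop :=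
  exists M : R, forall z : C, S z -> (Cmod z <= M)%R.

Definition finite_set (S : C -> Prop) : Prop :=
  exists l : list C, forall z : C, S z -> In z l.

Definition critical_value (f : C -> C) (w : C) : Prop :=
  exists w0 : C, @is_derive C_AbsRing C_NormedModule f w0 (RtoC 0) /\ w = f w0.

(* Curves tending to infinity are parametrized by [0, +oo). *)
Definition asymptotic_value (f : C -> C) (zeta : C) : Prop :=
  exists gamma : R -> C,
    continuous_on (fun t : R => (0 <= t)%R) gamma /\
    is_lim (fun t : R => Cmod (gamma t)) p_infty p_infty /\
    filterlim (fun t : R => f (gamma t)) (Rbar_locally p_infty) (locally zeta).

Definition singular_value (f : C -> C) (w : C) : Prop :=
  critical_value f w \/ asymptotic_value f w.

(* Sing(f^{-1}) *)
Definition Sing_inv (f : C -> C) (w : C) : Prop :=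
  singular_value f w \/ limit_point (singular_value f) w.

(* The Eremenko-Lyubich class B. *)
Definition class_B (f : C -> C) : Prop :=
  transcendental_entire f /\ bounded_set (Sing_inv f).

(* P(f) *)
Definition postsingular_set (f : C -> C) : C -> Prop :=
  closure (fun z => exists (n : nat) (w : C), Sing_inv f w /\ z = Nat.iter n f w).

Definition postsingularly_finite (f : C -> C) : Prop :=
  finite_set (postsingular_set f).

(* Main.v *)
Require Import Defs.
From Stdlib Require Import Reals Lra Lia Wf_nat List.
From Stdlib Require Import Classical ClassicalEpsilon FunctionalExtensionality.
From Coquelicot Require Import Coquelicot.

Local Open Scope C_scope.

(** Put [phi z = a * z + b], so that [g] is [phi] after [f^p].

    Comparing [f o g] with [g o f] shows that [phi] commutes with [f] on the
    range of [f^p].  That range is dense, because a nonconstant entire function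
    has dense range by Liouville's theorem and density passes to iterates; so
    [phi] commutes with [f] everywhere ([eq_on_dense_range]).  Consequently both
    [g] and [f o g] have the shape [phi o f^n], and [phi] maps critical values of
    [f] to critical values and asymptotic values to asymptotic values.

    Let [A] be the union of the forward orbits of the singular values of [f].
    It is finite since it lies in [P(f)], and it is invariant under [f] and
    [phi].  Every singular value of [phi o f^n] lies in [A]
    ([singular_value_affine_iter]).  For critical values this is the chain rule.
    For an asymptotic value of [f^(n+1)] along a curve [u], look at [f o u]:
    along it [f^n] has a limit, so [f o u] either tends to infinity, and one
    goes on with [f^n], or converges to a finite point, which is then an
    asymptotic value of [f] ([limit_dichotomy]).  The dichotomy holds because
    otherwise [f o u] would keep leaving and returning to a small disc around
    one of its accumulation points [y], crossing circles on which
    [f^n - f^n(y)] is bounded away from zero.  A finite set is closed, so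
    [P(phi o f^n)] stays inside [A].

    Two facts of function theory are needed: Liouville's theorem, and the
    estimate [c * |z - y|^N <= |h z - h y|] near [y] for nonconstant entire [h].
    Both are read off a Cauchy formula on circles about the origin.  Goursat's
    bisection argument, run on polar sectors, makes the integral of [q(z) dz]
    around a circle vanish for every continuous [q] that is differentiable off
    one point; take for [q] the divided difference of [h] at [w].  Expanding the
    Cauchy kernel to finite order replaces power series.  Crude
    constants suffice: the integral estimates lose a factor 2, and the
    normalizing integral, whose value is [2 * PI], is only bounded from below
    and above. *)

(** * Moduli and continuity of complex-valued functions *)

Lemma Cmod_sym (x y : C) : Cmod (x - y) = Cmod (y - x).
Proof. rewrite <- Cmod_opp. f_equal. ring. Qed.

Lemma Cmod_sub_lower (x y : C) : (Cmod x - Cmod y <= Cmod (x - y))%R.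
Proof.
  assert (H := Cmod_triangle (x - y) y).
  replace (x - y + y) with x in H by ring. lra.
Qed.

Lemma Cmod_le_parts (z : C) : (Cmod z <= Rabs (fst z) + Rabs (snd z))%R.
Proof.
  destruct z as [x y]. simpl.
  apply Rle_trans with (Cmod (RtoC x + Ci * RtoC y)).
  { right. f_equal. apply injective_projections; simpl; ring. }
  eapply Rle_trans; [apply Cmod_triangle|].
  rewrite Cmod_mult, !Cmod_R.
  replace (Cmod Ci) with 1%R; [lra|].
  unfold Cmod, Ci; simpl. replace (_ + _)%R with 1%R by ring. now rewrite sqrt_1.
Qed.

Lemma im_le_Cmod (z : C) : (Rabs (snd z) <= Cmod z)%R.
Proof.
  rewrite <- sqrt_Rsqr_abs. unfold Cmod. apply sqrt_le_1_alt. unfold Rsqr. nra.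
Qed.

Lemma locally_Cmod (z : C) (P : C -> Prop) :
  locally z P <->
  exists d, (0 < d)%R /\ forall y, (Cmod (y - z) < d)%R -> P y.
Proof.
  split.
  - intros [d Hd]. exists d. split; [apply cond_pos|].
    intros y Hy. apply Hd. apply C_NormedModule_mixin_compat1. exact Hy.
  - intros [d [Hd H]].
    assert (Hd2 : (0 < d / 2)%R) by lra.
    exists (mkposreal _ Hd2). intros y [B1 B2]. apply H.
    eapply Rle_lt_trans; [apply Cmod_le_parts|].
    unfold ball in B1, B2; simpl in B1, B2.
    unfold AbsRing_ball, abs, minus, plus, opp in B1, B2; simpl in B1, B2.
    simpl. unfold Rminus in *. lra.
Qed.

(** Continuity on the product uniform space is stated with boxes; the modulus
    form is the one that the estimates use. *)
Lemma continuous_Cmod {T : UniformSpace} (u : T -> C) (t : T) :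
  continuous u t <->
  forall e, (0 < e)%R -> locally t (fun s => (Cmod (u s - u t) < e)%R).
Proof.
  split.
  - intros H e He. apply (H (fun y => (Cmod (y - u t) < e)%R)).
    apply locally_Cmod. eauto.
  - intros H P HP. apply locally_Cmod in HP. destruct HP as [d [Hd HP]].
    unfold filtermap. generalize (H d Hd). apply filter_imp. auto.
Qed.

Lemma continuous_re {T : UniformSpace} (u : T -> C) (t : T) :
  continuous u t -> continuous (fun s => fst (u s)) t.
Proof.
  intros H. apply (continuous_comp u fst); [exact H|].
  destruct (u t). apply continuous_fst.
Qed.

Lemma continuous_im {T : UniformSpace} (u : T -> C) (t : T) :
  continuous u t -> continuous (fun s => snd (u s)) t.
Proof.
  intros H. apply (continuous_comp u snd); [exact H|].
  destruct (u t). apply continuous_snd.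
Qed.

Lemma continuous_parts {T : UniformSpace} (u : T -> C) (t : T) :
  continuous (fun s => fst (u s)) t -> continuous (fun s => snd (u s)) t ->
  continuous u t.
Proof.
  intros H1 H2.
  apply (continuous_ext (fun s => (fst (u s), snd (u s)))).
  { intros s; now destruct (u s). }
  apply (continuous_comp_2 (fun s => fst (u s)) (fun s => snd (u s))
           (fun x y => (x, y) : C) t H1 H2).
  apply (continuous_ext (fun x => x)); [now intros [x y]|].
  apply continuous_id.
Qed.

Lemma continuous_Cplus {T : UniformSpace} (u v : T -> C) (t : T) :
  continuous u t -> continuous v t -> continuous (fun s => u s + v s) t.
Proof.
  intros Hu Hv. apply continuous_parts; simpl;
  apply (continuous_plus (V := R_NormedModule));
  auto using continuous_re, continuous_im.
Qed.

Lemma continuous_Copp {T : UniformSpace} (u : T -> C) (t : T) :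
  continuous u t -> continuous (fun s => - u s) t.
Proof.
  intros Hu. apply continuous_parts; simpl;
  apply (continuous_opp (V := R_NormedModule));
  auto using continuous_re, continuous_im.
Qed.

Lemma continuous_Cminus {T : UniformSpace} (u v : T -> C) (t : T) :
  continuous u t -> continuous v t -> continuous (fun s => u s - v s) t.
Proof. intros. apply continuous_Cplus; auto using continuous_Copp. Qed.

Lemma continuous_Cmult {T : UniformSpace} (u v : T -> C) (t : T) :
  continuous u t -> continuous v t -> continuous (fun s => u s * v s) t.
Proof.
  intros Hu Hv. apply continuous_parts; simpl.
  - apply (continuous_minus (V := R_NormedModule));
    apply (continuous_mult (K := R_AbsRing));
    auto using continuous_re, continuous_im.
  - apply (continuous_plus (V := R_NormedModule));
    apply (continuous_mult (K := R_AbsRing));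
    auto using continuous_re, continuous_im.
Qed.

Lemma continuous_Cinv {T : UniformSpace} (u : T -> C) (t : T) :
  u t <> 0 -> continuous u t -> continuous (fun s => / u s) t.
Proof.
  intros Hn Hu.
  assert (Hm : (fst (u t) ^ 2 + snd (u t) ^ 2 <> 0)%R).
  { intros H. apply Hn. apply injective_projections; simpl; nra. }
  assert (C1 := continuous_re u t Hu). assert (C2 := continuous_im u t Hu).
  assert (Sq : forall v : T -> R, continuous v t -> continuous (fun s => (v s ^ 2)%R) t).
  { intros v Cv. apply (continuous_mult (K := R_AbsRing) v (fun s => (v s * 1)%R)); [exact Cv|].
    apply (continuous_mult (K := R_AbsRing) v (fun _ => 1%R)); [exact Cv|].
    apply continuous_const. }
  assert (Ci : continuous (fun s => (/ (fst (u s) ^ 2 + snd (u s) ^ 2))%R) t).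
  { apply (continuous_comp (fun s => (fst (u s) ^ 2 + snd (u s) ^ 2)%R) Rinv);
      [|now apply continuous_Rinv].
    apply (continuous_plus (V := R_NormedModule)); apply Sq; assumption. }
  apply continuous_parts; simpl; unfold Rdiv;
    apply (continuous_mult (K := R_AbsRing)); auto.
  now apply (continuous_opp (V := R_NormedModule)).
Qed.

Lemma continuous_Cpow {T : UniformSpace} (u : T -> C) (t : T) (n : nat) :
  continuous u t -> continuous (fun s => u s ^ n) t.
Proof.
  intros H. induction n as [|n IH]; simpl.
  - apply continuous_const.
  - now apply continuous_Cmult.
Qed.

Lemma continuous_RtoC {T : UniformSpace} (x : T -> R) (t : T) :
  continuous x t -> continuous (fun s => RtoC (x s)) t.
Proof. intros. apply continuous_parts; simpl; auto. apply continuous_const. Qed.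

(** In [is_derive] the domain carries the uniform structure of [C_AbsRing] and the
    codomain that of [C_NormedModule], so derivatives of self-maps of [C] do not
    compose directly.  The epsilon form is symmetric in the two. *)
Definition is_Cderive (h : C -> C) (z l : C) : Prop :=
  forall e, (0 < e)%R -> exists d, (0 < d)%R /\
  forall y, (Cmod (y - z) < d)%R ->
  (Cmod (h y - h z - l * (y - z)) <= e * Cmod (y - z))%R.

Lemma is_derive_Cderive (h : C -> C) (z l : C) :
  @is_derive C_AbsRing C_NormedModule h z l <-> is_Cderive h z l.
Proof.
  split.
  - intros [_ H] e He.
    specialize (H z (fun P HP => HP) (mkposreal e He)).
    destruct H as [d Hd]. exists d. split; [apply cond_pos|].
    intros y Hy. specialize (Hd y Hy).
    change (Cmod (h y - h z - (y - z) * l) <= e * Cmod (y - z))%R in Hd.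
    now rewrite (Cmult_comm l).
  - intros H. split.
    + apply is_linear_scal_l.
    + intros x Hx e.
      replace x with z in *.
      2:{ apply (is_filter_lim_locally_unique (V := AbsRing_NormedModule C_AbsRing)); auto. }
      destruct (H e (cond_pos e)) as [d [Hd Hy]].
      exists (mkposreal d Hd). intros y By.
      change (Cmod (h y - h z - (y - z) * l) <= e * Cmod (y - z))%R.
      rewrite (Cmult_comm _ l). now apply Hy.
Qed.

(** * Complex derivatives and divided differences *)

(** The value at the exceptional point is a parameter, so that it can be set to
    the derivative, which makes the function continuous there. *)
Definition divided_difference (h : C -> C) (w l : C) (z : C) : C :=
  if Ceq_dec z w then l else (h z - h w) / (z - w).

Lemma divided_difference_mul (h : C -> C) (w l z : C) :
  divided_difference h w l z * (z - w) = h z - h w.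
Proof.
  unfold divided_difference. destruct (Ceq_dec z w) as [->|n].
  - ring.
  - field. now apply Cminus_eq_contra.
Qed.

Lemma divided_difference_at (h : C -> C) (w l : C) :
  divided_difference h w l w = l.
Proof. unfold divided_difference. now destruct (Ceq_dec w w). Qed.

Lemma divided_difference_continuous_at (h : C -> C) (w l : C) :
  is_Cderive h w l -> continuous (divided_difference h w l) w.
Proof.
  intros H. apply continuous_Cmod. intros e He.
  destruct (H (e / 2)%R ltac:(lra)) as [d [Hd Hy]].
  apply locally_Cmod. exists d. split; [exact Hd|]. intros y By.
  rewrite divided_difference_at.
  destruct (Ceq_dec y w) as [->|n].
  { rewrite divided_difference_at. replace (l - l) with (RtoC 0) by ring.
    now rewrite Cmod_0. }
  specialize (Hy y By).
  rewrite <- (divided_difference_mul h w l y) in Hy.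
  replace (_ - l * (y - w)) with ((divided_difference h w l y - l) * (y - w)) in Hy by ring.
  rewrite Cmod_mult in Hy.
  assert (0 < Cmod (y - w))%R by now apply Cmod_gt_0, Cminus_eq_contra.
  nra.
Qed.

(** Caratheodory's form of differentiability reduces the calculus rules below to
    the algebra of continuous functions. *)
Lemma is_Cderive_caratheodory (h : C -> C) (z l : C) :
  is_Cderive h z l <->
  exists q : C -> C, locally z (fun y => h y - h z = q y * (y - z)) /\
    continuous q z /\ q z = l.
Proof.
  split.
  - intros H. exists (divided_difference h z l). repeat split.
    + apply filter_forall. intros y. now rewrite divided_difference_mul.
    + now apply divided_difference_continuous_at.
    + apply divided_difference_at.
  - intros [q [Hq [Cq <-]]] e He.
    rewrite continuous_Cmod in Cq. specialize (Cq e He).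
    destruct (proj1 (locally_Cmod _ _) (filter_and _ _ Hq Cq)) as [d [Hd H]].
    exists d. split; [exact Hd|]. intros y By.
    destruct (H y By) as [E Hl]. rewrite E.
    replace (q y * (y - z) - q z * (y - z)) with ((q y - q z) * (y - z)) by ring.
    rewrite Cmod_mult. apply Rmult_le_compat_r; [apply Cmod_ge_0|lra].
Qed.

Lemma is_Cderive_continuous (h : C -> C) (z l : C) : is_Cderive h z l -> continuous h z.
Proof.
  intros H. apply is_Cderive_caratheodory in H. destruct H as [q [Hq [Cq _]]].
  apply (continuous_ext_loc _ (fun y => h z + q y * (y - z))).
  - revert Hq. apply filter_imp. intros y <-. change (h z + (h y - h z) = h y :> C). ring.
  - apply continuous_Cplus; [apply continuous_const|].
    apply continuous_Cmult; [exact Cq|].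
    apply continuous_Cminus; [apply continuous_id|apply continuous_const].
Qed.

Lemma is_Cderive_ext_loc (h k : C -> C) (z l : C) :
  locally z (fun y => h y = k y) -> is_Cderive h z l -> is_Cderive k z l.
Proof.
  intros He H. apply is_Cderive_caratheodory in H. destruct H as [q [Hq [Cq El]]].
  apply is_Cderive_caratheodory. exists q. repeat split; auto.
  generalize (filter_and _ _ He Hq). apply filter_imp. intros y [<- H].
  now rewrite <- (locally_singleton _ _ He).
Qed.

Lemma is_Cderive_ext (h k : C -> C) (z l : C) :
  (forall y, h y = k y) -> is_Cderive h z l -> is_Cderive k z l.
Proof. intros E. apply is_Cderive_ext_loc, filter_forall, E. Qed.

Lemma is_Cderive_const (c z : C) : is_Cderive (fun _ => c) z 0.
Proof.
  apply is_Cderive_caratheodory. exists (fun _ => RtoC 0). repeat split.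
  - apply filter_forall. intros y. ring.
  - apply continuous_const.
Qed.

Lemma is_Cderive_id (z : C) : is_Cderive (fun y => y) z 1.
Proof.
  apply is_Cderive_caratheodory. exists (fun _ => RtoC 1). repeat split.
  - apply filter_forall. intros y. ring.
  - apply continuous_const.
Qed.

Lemma is_Cderive_plus (h k : C -> C) (z l m : C) :
  is_Cderive h z l -> is_Cderive k z m -> is_Cderive (fun y => h y + k y) z (l + m).
Proof.
  rewrite !is_Cderive_caratheodory. intros [q [Hq [Cq <-]]] [r [Hr [Cr <-]]].
  exists (fun y => q y + r y). repeat split.
  - generalize (filter_and _ _ Hq Hr). apply filter_imp. intros y [H1 H2].
    replace (h y + k y - (h z + k z)) with ((h y - h z) + (k y - k z)) by ring.
    rewrite H1, H2. ring.
  - now apply continuous_Cplus.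
Qed.

Lemma is_Cderive_mult (h k : C -> C) (z l m : C) :
  is_Cderive h z l -> is_Cderive k z m -> is_Cderive (fun y => h y * k y) z (l * k z + h z * m).
Proof.
  intros Hh Hk. assert (Ck := is_Cderive_continuous _ _ _ Hk). revert Hh Hk.
  rewrite !is_Cderive_caratheodory. intros [q [Hq [Cq <-]]] [r [Hr [Cr <-]]].
  exists (fun y => q y * k y + h z * r y). repeat split.
  - generalize (filter_and _ _ Hq Hr). apply filter_imp. intros y [H1 H2].
    replace (h y * k y - h z * k z) with ((h y - h z) * k y + h z * (k y - k z)) by ring.
    rewrite H1, H2. ring.
  - apply continuous_Cplus; apply continuous_Cmult; auto. apply continuous_const.
Qed.

Lemma is_Cderive_scal (c : C) (h : C -> C) (z l : C) :
  is_Cderive h z l -> is_Cderive (fun y => c * h y) z (c * l).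
Proof.
  intros H. assert (G := is_Cderive_mult _ _ _ _ _ (is_Cderive_const c z) H).
  replace (c * l) with (0 * h z + c * l) by ring. exact G.
Qed.

Lemma is_Cderive_minus_const (h : C -> C) (c z l : C) :
  is_Cderive h z l -> is_Cderive (fun y => h y - c) z l.
Proof.
  intros H. assert (G := is_Cderive_plus _ _ _ _ _ H (is_Cderive_const (- c) z)).
  replace l with (l + 0) by ring. exact G.
Qed.

Lemma is_Cderive_inv (h : C -> C) (z l : C) :
  h z <> 0 -> is_Cderive h z l -> is_Cderive (fun y => / h y) z (- l / (h z * h z)).
Proof.
  intros Hn Hh. assert (Ch := is_Cderive_continuous _ _ _ Hh). revert Hh.
  rewrite !is_Cderive_caratheodory. intros [q [Hq [Cq <-]]].
  exists (fun y => - q y * / (h y * h z)). repeat split.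
  - assert (Hn' : locally z (fun y => h y <> 0)).
    { assert (Hp : (0 < Cmod (h z))%R) by now apply Cmod_gt_0.
      rewrite continuous_Cmod in Ch. generalize (Ch _ Hp). apply filter_imp.
      intros y Hy E. rewrite E, Cmod_sym in Hy.
      replace (h z - 0) with (h z) in Hy by ring. lra. }
    generalize (filter_and _ _ Hq Hn'). apply filter_imp. intros y [H1 H2].
    replace (- q y * / (h y * h z) * (y - z)) with
      (- (q y * (y - z)) * / (h y * h z)) by ring.
    rewrite <- H1. field. auto.
  - apply continuous_Cmult; [now apply continuous_Copp|].
    apply (continuous_Cinv (fun y => h y * h z)); [now apply Cmult_neq_0|].
    apply continuous_Cmult; [exact Ch|apply continuous_const].
Qed.

Lemma is_Cderive_comp (f g : C -> C) (z l m : C) :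
  is_Cderive f (g z) l -> is_Cderive g z m -> is_Cderive (fun y => f (g y)) z (l * m).
Proof.
  intros Hf Hg. assert (Cg := is_Cderive_continuous _ _ _ Hg). revert Hf Hg.
  rewrite !is_Cderive_caratheodory. intros [q [Hq [Cq <-]]] [r [Hr [Cr <-]]].
  exists (fun y => q (g y) * r y). repeat split.
  - assert (Hqg : locally z (fun y => f (g y) - f (g z) = q (g y) * (g y - g z)))
      by exact (Cg _ Hq).
    generalize (filter_and _ _ Hqg Hr). apply filter_imp. intros y [H1 H2]. cbv beta in H1.
    rewrite H1, H2. ring.
  - apply continuous_Cmult; [|exact Cr]. now apply (continuous_comp g q).
Qed.

Lemma is_Cderive_unique (h : C -> C) (z l m : C) : is_Cderive h z l -> is_Cderive h z m -> l = m.
Proof.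
  intros Hl Hm. apply is_derive_Cderive in Hl. apply is_derive_Cderive in Hm.
  rewrite <- (is_C_derive_unique _ _ _ Hl). now apply is_C_derive_unique.
Qed.

Lemma entire_Cderive (h : C -> C) : entire h <-> forall z, exists l, is_Cderive h z l.
Proof.
  split; intros H z; destruct (H z) as [l Hl]; exists l; now apply is_derive_Cderive.
Qed.

Definition continuous_map (q : C -> C) : Prop := forall z, continuous q z.

Lemma entire_continuous (h : C -> C) : entire h -> continuous_map h.
Proof.
  intros H z. destruct (proj1 (entire_Cderive h) H z) as [l Hl].
  eapply is_Cderive_continuous, Hl.
Qed.

Lemma entire_comp (f g : C -> C) : entire f -> entire g -> entire (fun z => f (g z)).
Proof.
  rewrite !entire_Cderive. intros Hf Hg z.
  destruct (Hg z) as [m Hm]. destruct (Hf (g z)) as [l Hl].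
  exists (l * m). now apply is_Cderive_comp.
Qed.

Lemma entire_affine (a b : C) : entire (fun z => a * z + b).
Proof.
  apply entire_Cderive. intros z. exists (a * 1 + 0).
  apply is_Cderive_plus; [apply is_Cderive_scal, is_Cderive_id|apply is_Cderive_const].
Qed.

Lemma entire_iter (f : C -> C) (n : nat) : entire f -> entire (Nat.iter n f).
Proof.
  intros Hf. induction n as [|n IH].
  - apply entire_Cderive. intros z. exists 1. apply is_Cderive_id.
  - apply (entire_comp f (Nat.iter n f)); auto.
Qed.

Lemma divided_difference_away (h : C -> C) (w l z : C) : z <> w ->
  locally z (fun y => (h y - h w) * / (y - w) = divided_difference h w l y).
Proof.
  intros n.
  assert (Hp : (0 < Cmod (z - w))%R) by now apply Cmod_gt_0, Cminus_eq_contra.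
  apply locally_Cmod. exists (Cmod (z - w)). split; [exact Hp|].
  intros y Hy. unfold divided_difference. destruct (Ceq_dec y w) as [->|]; [|reflexivity].
  rewrite Cmod_sym in Hy. lra.
Qed.

Lemma divided_difference_derivable (h : C -> C) (w l : C) :
  entire h -> forall z, z <> w -> exists m, is_Cderive (divided_difference h w l) z m.
Proof.
  intros He z n. destruct (proj1 (entire_Cderive h) He z) as [m Hm].
  eexists. apply (is_Cderive_ext_loc _ _ _ _ (divided_difference_away h w l z n)).
  apply (is_Cderive_mult (fun y => h y - h w) (fun y => / (y - w))).
  - apply is_Cderive_minus_const, Hm.
  - apply (is_Cderive_inv (fun y => y - w)); [now apply Cminus_eq_contra|].
    apply is_Cderive_minus_const, is_Cderive_id.
Qed.

Lemma divided_difference_continuous (h : C -> C) (w l : C) :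
  entire h -> is_Cderive h w l -> continuous_map (divided_difference h w l).
Proof.
  intros He Hw z. destruct (Ceq_dec z w) as [->|n].
  - now apply divided_difference_continuous_at.
  - destruct (divided_difference_derivable h w l He z n) as [m Hm].
    exact (is_Cderive_continuous _ _ _ Hm).
Qed.

(** * Contour integrals over polar sectors *)

Definition CInt (u : R -> C) (a b : R) : C :=
  (RInt (fun t => fst (u t)) a b, RInt (fun t => snd (u t)) a b).

Definition continuous_path (u : R -> C) : Prop := forall t, continuous u t.

Lemma ex_RInt_re (u : R -> C) (a b : R) : continuous_path u -> ex_RInt (fun t => fst (u t)) a b.
Proof.
  intros H. apply (ex_RInt_continuous (V := R_CompleteNormedModule)).
  intros t _. now apply continuous_re.
Qed.

Lemma ex_RInt_im (u : R -> C) (a b : R) : continuous_path u -> ex_RInt (fun t => snd (u t)) a b.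
Proof.
  intros H. apply (ex_RInt_continuous (V := R_CompleteNormedModule)).
  intros t _. now apply continuous_im.
Qed.

Lemma CInt_ext (u v : R -> C) (a b : R) :
  (forall t, u t = v t) -> CInt u a b = CInt v a b.
Proof. intros H. apply injective_projections; apply RInt_ext; intros; now rewrite H. Qed.

Lemma CInt_plus (u v : R -> C) (a b : R) : continuous_path u -> continuous_path v ->
  CInt (fun t => u t + v t) a b = CInt u a b + CInt v a b.
Proof.
  intros Hu Hv. apply injective_projections; simpl;
  apply (RInt_plus (V := R_CompleteNormedModule)); auto using ex_RInt_re, ex_RInt_im.
Qed.

Lemma CInt_scal (c : C) (u : R -> C) (a b : R) : continuous_path u ->
  CInt (fun t => c * u t) a b = c * CInt u a b.
Proof.
  intros Hu.
  assert (S : forall k f, ex_RInt f a b ->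
    RInt (fun t => (k * f t)%R) a b = (k * RInt f a b)%R).
  { intros k f. apply (RInt_scal (V := R_CompleteNormedModule)). }
  assert (X : forall k f, ex_RInt f a b -> ex_RInt (fun t => (k * f t)%R) a b).
  { intros k f. apply (ex_RInt_scal (V := R_CompleteNormedModule)). }
  assert (Hr := ex_RInt_re u a b Hu). assert (Hi := ex_RInt_im u a b Hu).
  apply injective_projections; simpl.
  - rewrite <- !S by auto.
    apply (RInt_minus (V := R_CompleteNormedModule) (fun t => fst c * fst (u t))%R
      (fun t => snd c * snd (u t))%R); auto.
  - rewrite <- !S by auto.
    apply (RInt_plus (V := R_CompleteNormedModule) (fun t => fst c * snd (u t))%R
      (fun t => snd c * fst (u t))%R); auto.
Qed.

Lemma CInt_minus (u v : R -> C) (a b : R) : continuous_path u -> continuous_path v ->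
  CInt (fun t => u t - v t) a b = CInt u a b - CInt v a b.
Proof.
  intros Hu Hv. apply injective_projections; simpl;
  apply (RInt_minus (V := R_CompleteNormedModule) (fun t => _ (u t)));
  auto using ex_RInt_re, ex_RInt_im.
Qed.

Lemma CInt_Chasles (u : R -> C) (a b c : R) : continuous_path u ->
  CInt u a b + CInt u b c = CInt u a c.
Proof.
  intros Hu. apply injective_projections; simpl;
  apply (RInt_Chasles (V := R_CompleteNormedModule)); auto using ex_RInt_re, ex_RInt_im.
Qed.

(** The factor 2 comes from treating real and imaginary parts separately; it
    avoids proving the triangle inequality for complex integrals. *)
Lemma CInt_bound (u : R -> C) (a b M : R) : (a <= b)%R -> continuous_path u ->
  (forall t, (a <= t <= b)%R -> (Cmod (u t) <= M)%R) ->
  (Cmod (CInt u a b) <= 2 * M * (b - a))%R.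
Proof.
  intros Hab Hu HM. eapply Rle_trans; [apply Cmod_le_parts|]. simpl.
  assert (H1 := abs_RInt_le_const _ a b M Hab (ex_RInt_re u a b Hu)).
  assert (H2 := abs_RInt_le_const _ a b M Hab (ex_RInt_im u a b Hu)).
  assert (B1 : (Rabs (RInt (fun t => fst (u t)) a b) <= (b - a) * M)%R).
  { apply H1. intros t Ht. eapply Rle_trans; [apply re_le_Cmod|auto]. }
  assert (B2 : (Rabs (RInt (fun t => snd (u t)) a b) <= (b - a) * M)%R).
  { apply H2. intros t Ht. eapply Rle_trans; [apply im_le_Cmod|auto]. }
  lra.
Qed.

Lemma CInt_derive (F u : R -> C) (a b : R) : continuous_path u ->
  (forall t, is_derive (fun s => fst (F s)) t (fst (u t))) ->
  (forall t, is_derive (fun s => snd (F s)) t (snd (u t))) ->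
  CInt u a b = F b - F a.
Proof.
  intros Hu H1 H2. apply injective_projections; simpl;
  apply is_RInt_unique.
  - apply (is_RInt_derive (V := R_CompleteNormedModule) (fun s => fst (F s))); intros; auto.
    now apply continuous_re.
  - apply (is_RInt_derive (V := R_CompleteNormedModule) (fun s => snd (F s))); intros; auto.
    now apply continuous_im.
Qed.

Definition unit_vec (t : R) : C := (cos t, sin t).

Lemma unit_vec_continuous : continuous_path unit_vec.
Proof.
  intros t. apply continuous_parts; simpl.
  - apply continuous_cos.
  - apply continuous_sin.
Qed.

Lemma Cmod_unit_vec (t : R) : Cmod (unit_vec t) = 1%R.
Proof.
  unfold Cmod, unit_vec; cbn [fst snd].
  replace (_ + _)%R with 1%R; [apply sqrt_1|].
  rewrite <- (sin2_cos2 t). unfold Rsqr. ring.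
Qed.

Lemma unit_vec_lipschitz (s t : R) :
  (Cmod (unit_vec s - unit_vec t) <= 2 * Rabs (s - t))%R.
Proof.
  assert (L : forall f df : R -> R, (forall x, is_derive f x (df x)) ->
    (forall x, (Rabs (df x) <= 1)%R) -> (Rabs (f s - f t) <= Rabs (s - t))%R).
  { intros f df Hd Hb.
    destruct (MVT_gen f t s df) as [c [_ ->]].
    - intros; apply Hd.
    - intros x _. apply continuity_pt_filterlim.
      apply (ex_derive_continuous (K := R_AbsRing) (V := R_NormedModule)).
      now exists (df x).
    - rewrite Rabs_mult. assert (H := Hb c). assert (P := Rabs_pos (s - t)). nra. }
  eapply Rle_trans; [apply Cmod_le_parts|]. simpl.
  assert (H1 := L cos (fun x => - sin x)%R).
  assert (H2 := L sin cos).
  assert (Bs : forall x, (Rabs (sin x) <= 1)%R).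
  { intros x. apply Rabs_le. destruct (SIN_bound x). lra. }
  assert (Bc : forall x, (Rabs (cos x) <= 1)%R).
  { intros x. apply Rabs_le. destruct (COS_bound x). lra. }
  unfold Rminus in *.
  enough (Rabs (cos s + - cos t) <= Rabs (s + - t) /\
          Rabs (sin s + - sin t) <= Rabs (s + - t))%R by lra.
  split.
  - apply H1.
    + intros x. apply is_derive_cos.
    + intros x. now rewrite Rabs_Ropp.
  - apply H2; auto. intros x. apply is_derive_sin.
Qed.

Definition polar (r t : R) : C := RtoC r * unit_vec t.

Lemma Cmod_polar (r t : R) : (0 <= r)%R -> Cmod (polar r t) = r.
Proof.
  intros H. unfold polar. rewrite Cmod_mult, Cmod_unit_vec, Cmod_R, Rabs_pos_eq; lra.
Qed.

Lemma polar_continuous_angle (r : R) : continuous_path (polar r).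
Proof. intros t. apply continuous_Cmult; [apply continuous_const|apply unit_vec_continuous]. Qed.

Lemma polar_continuous_radius (t : R) : continuous_path (fun r => polar r t).
Proof.
  intros r. apply continuous_Cmult; [|apply continuous_const].
  apply continuous_RtoC, continuous_id.
Qed.

(** The contour integral of [q(z) dz] along a circular arc: [Ci * polar r t] is
    the velocity in the angle [t]. *)
Definition arc (q : C -> C) (r t1 t2 : R) : C :=
  CInt (fun t => q (polar r t) * (Ci * polar r t)) t1 t2.

(** The contour integral of [q(z) dz] along a radial segment: [unit_vec t] is the
    velocity in the radius. *)
Definition ray (q : C -> C) (t r1 r2 : R) : C :=
  CInt (fun r => q (polar r t) * unit_vec t) r1 r2.

(** The integral of [q(z) dz] around the boundary of a polar sector.  Sectors
    with inner radius 0 are allowed, which lets the circle theorem start from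
    the degenerate circle. *)
Definition sector (q : C -> C) (r1 r2 t1 t2 : R) : C :=
  arc q r2 t1 t2 - arc q r1 t1 t2 - (ray q t2 r1 r2 - ray q t1 r1 r2).

Lemma arc_integrand_continuous (q : C -> C) (r : R) : continuous_map q ->
  continuous_path (fun t => q (polar r t) * (Ci * polar r t)).
Proof.
  intros Hq t. apply continuous_Cmult.
  - apply (continuous_comp (polar r) q); [apply polar_continuous_angle|apply Hq].
  - apply continuous_Cmult; [apply continuous_const|apply polar_continuous_angle].
Qed.

Lemma ray_integrand_continuous (q : C -> C) (t : R) : continuous_map q ->
  continuous_path (fun r => q (polar r t) * unit_vec t).
Proof.
  intros Hq r. apply continuous_Cmult; [|apply continuous_const].
  apply (continuous_comp (fun r => polar r t) q); [apply polar_continuous_radius|apply Hq].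
Qed.

(** The integrals over the inner edges cancel. *)
Lemma sector_split (q : C -> C) (r1 r2 r3 t1 t2 t3 : R) : continuous_map q ->
  sector q r1 r3 t1 t3 =
  sector q r1 r2 t1 t2 + sector q r1 r2 t2 t3 +
  (sector q r2 r3 t1 t2 + sector q r2 r3 t2 t3).
Proof.
  intros Hq. unfold sector, arc, ray.
  rewrite <- (CInt_Chasles _ t1 t2 t3 (arc_integrand_continuous q r1 Hq)).
  rewrite <- (CInt_Chasles _ t1 t2 t3 (arc_integrand_continuous q r3 Hq)).
  rewrite <- (CInt_Chasles _ r1 r2 r3 (ray_integrand_continuous q t1 Hq)).
  rewrite <- (CInt_Chasles _ r1 r2 r3 (ray_integrand_continuous q t3 Hq)).
  ring.
Qed.

Lemma sector_plus (q k : C -> C) (r1 r2 t1 t2 : R) : continuous_map q -> continuous_map k ->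
  sector (fun z => q z + k z) r1 r2 t1 t2 = sector q r1 r2 t1 t2 + sector k r1 r2 t1 t2.
Proof.
  intros Hq Hk.
  assert (HA : forall r, arc (fun z => q z + k z) r t1 t2 = arc q r t1 t2 + arc k r t1 t2).
  { intros r. unfold arc.
    rewrite <- (CInt_plus _ _ _ _ (arc_integrand_continuous q r Hq)
      (arc_integrand_continuous k r Hk)).
    apply CInt_ext. intros t. ring. }
  assert (HR : forall t, ray (fun z => q z + k z) t r1 r2 = ray q t r1 r2 + ray k t r1 r2).
  { intros t. unfold ray.
    rewrite <- (CInt_plus _ _ _ _ (ray_integrand_continuous q t Hq)
      (ray_integrand_continuous k t Hk)).
    apply CInt_ext. intros r. ring. }
  unfold sector. rewrite !HA, !HR. ring.
Qed.

(** An affine function has a primitive. *)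
Lemma sector_affine (A B : C) (r1 r2 t1 t2 : R) :
  sector (fun z => A + B * z) r1 r2 t1 t2 = 0.
Proof.
  assert (Hq : continuous_map (fun z => A + B * z)).
  { intros z. apply continuous_Cplus; [apply continuous_const|].
    apply continuous_Cmult; [apply continuous_const|apply continuous_id]. }
  set (Q := fun z : C => A * z + RtoC (1 / 2) * B * (z * z)).
  assert (HA : forall r s t, arc (fun z => A + B * z) r s t = Q (polar r t) - Q (polar r s)).
  { intros r s t. apply (CInt_derive (fun t => Q (polar r t))).
    - exact (arc_integrand_continuous _ r Hq).
    - intros x. destruct A as [a1 a2], B as [b1 b2]. unfold Q, polar, unit_vec.
      cbn [fst snd Cplus Cmult RtoC Ci]. auto_derive; [easy|]. field.
    - intros x. destruct A as [a1 a2], B as [b1 b2]. unfold Q, polar, unit_vec.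
      cbn [fst snd Cplus Cmult RtoC Ci]. auto_derive; [easy|]. field. }
  assert (HR : forall t r s, ray (fun z => A + B * z) t r s = Q (polar s t) - Q (polar r t)).
  { intros t r s. apply (CInt_derive (fun r => Q (polar r t))).
    - exact (ray_integrand_continuous _ t Hq).
    - intros x. destruct A as [a1 a2], B as [b1 b2]. unfold Q, polar, unit_vec.
      cbn [fst snd Cplus Cmult RtoC Ci]. auto_derive; [easy|]. field.
    - intros x. destruct A as [a1 a2], B as [b1 b2]. unfold Q, polar, unit_vec.
      cbn [fst snd Cplus Cmult RtoC Ci]. auto_derive; [easy|]. field. }
  unfold sector. rewrite !HA, !HR. ring.
Qed.

Lemma sector_bound (q : C -> C) (r1 r2 t1 t2 M : R) :
  continuous_map q -> (0 <= r1 <= r2)%R -> (t1 <= t2)%R ->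
  (forall r t, (r1 <= r <= r2)%R -> (t1 <= t <= t2)%R -> (Cmod (q (polar r t)) <= M)%R) ->
  (Cmod (sector q r1 r2 t1 t2) <= 4 * M * (r2 * (t2 - t1) + (r2 - r1)))%R.
Proof.
  intros Hq Hr Ht HM.
  assert (M0 : (0 <= M)%R).
  { eapply Rle_trans; [apply Cmod_ge_0|apply (HM r1 t1); lra]. }
  assert (HA : forall r, (r1 <= r <= r2)%R ->
    (Cmod (arc q r t1 t2) <= 2 * (M * r2) * (t2 - t1))%R).
  { intros r Hr'. apply CInt_bound; [exact Ht|now apply arc_integrand_continuous|].
    intros t Ht'. rewrite !Cmod_mult, Cmod_polar by lra.
    replace (Cmod Ci) with 1%R.
    2:{ unfold Cmod, Ci; simpl. replace (_ + _)%R with 1%R by ring. now rewrite sqrt_1. }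
    rewrite Rmult_1_l. apply Rmult_le_compat; try lra; [apply Cmod_ge_0|auto]. }
  assert (HR : forall t, (t1 <= t <= t2)%R ->
    (Cmod (ray q t r1 r2) <= 2 * M * (r2 - r1))%R).
  { intros t Ht'. apply CInt_bound; [lra|now apply ray_integrand_continuous|].
    intros r Hr'. rewrite Cmod_mult, Cmod_unit_vec, Rmult_1_r. auto. }
  unfold sector.
  assert (T : forall x y z w, (Cmod (x - y - (z - w)) <= Cmod x + Cmod y + Cmod z + Cmod w)%R).
  { intros x y z w. replace (x - y - (z - w)) with (x + - y + (- z + w)) by ring.
    assert (H1 := Cmod_triangle (x + - y) (- z + w)).
    assert (H2 := Cmod_triangle x (- y)). assert (H3 := Cmod_triangle (- z) w).
    rewrite Cmod_opp in H2, H3. lra. }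
  eapply Rle_trans; [apply T|].
  assert (H1 := HA r1 ltac:(lra)). assert (H2 := HA r2 ltac:(lra)).
  assert (H3 := HR t1 ltac:(lra)). assert (H4 := HR t2 ltac:(lra)).
  lra.
Qed.

(** * The Cauchy-Goursat theorem for polar sectors *)

Lemma nested_intervals (a b : nat -> R) :
  (forall n, (a n <= a (S n))%R) -> (forall n, (b (S n) <= b n)%R) ->
  (forall n, (a n <= b n)%R) -> exists x, forall n, (a n <= x <= b n)%R.
Proof.
  intros Ha Hb Hab.
  assert (Hc : forall n m, (a n <= b m)%R).
  { intros n m.
    apply Rle_trans with (a (max n m)); [|apply Rle_trans with (b (max n m))].
    - assert (G : Un_growing a) by exact Ha.
      apply Rge_le, (growing_prop a (max n m) n G). lia.
    - apply Hab.
    - assert (G : Un_growing (fun n => - b n)%R).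
      { intros k. specialize (Hb k). lra. }
      assert (K := growing_prop _ (max n m) m G ltac:(lia)). cbv beta in K. lra. }
  destruct (completeness (fun x => exists n, x = a n)) as [x [Hu Hl]].
  - exists (b O). intros x [n ->]. apply Hc.
  - exists (a O), O. reflexivity.
  - exists x. intros n. split.
    + apply Hu. now exists n.
    + apply Hl. intros y [m ->]. apply Hc.
Qed.

Lemma polar_lipschitz (r s t u : R) : (0 <= s)%R ->
  (Cmod (polar r t - polar s u) <= Rabs (r - s) + 2 * s * Rabs (t - u))%R.
Proof.
  intros Hs. unfold polar.
  replace (r * unit_vec t - s * unit_vec u) with
    (RtoC (r - s) * unit_vec t + RtoC s * (unit_vec t - unit_vec u)).
  2:{ rewrite RtoC_minus. ring. }
  eapply Rle_trans; [apply Cmod_triangle|].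
  rewrite !Cmod_mult, Cmod_unit_vec, !Cmod_R, (Rabs_pos_eq s Hs).
  assert (H := unit_vec_lipschitz t u).
  assert (s * Cmod (unit_vec t - unit_vec u) <= s * (2 * Rabs (t - u)))%R
    by now apply Rmult_le_compat_l.
  lra.
Qed.

(** Near a point of differentiability [q] is affine up to an error that is small
    compared with the distance.  The affine part integrates to zero, the error is
    a small multiple of the size of the sector, and the perimeter is of the order
    of that size because the radii are at most [R0]. *)
Lemma small_sector (q : C -> C) (r0 t0 R0 eta : R) (l : C) :
  continuous_map q -> (0 < eta)%R -> is_Cderive q (polar r0 t0) l ->
  exists d, (0 < d)%R /\ forall r1 r2 t1 t2,
    (0 <= r1 <= r2)%R -> (t1 <= t2)%R -> (r2 <= R0)%R ->
    (r1 <= r0 <= r2)%R -> (t1 <= t0 <= t2)%R ->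
    (r2 - r1 + (t2 - t1) < d)%R ->
    (Cmod (sector q r1 r2 t1 t2) <= eta * (r2 - r1 + (t2 - t1)) ^ 2)%R.
Proof.
  intros Hq He Hd.
  destruct (Rlt_le_dec R0 0) as [Hn|HR].
  { exists 1%R. split; [lra|]. intros. lra. }
  set (K := (1 + 2 * R0)%R).
  assert (HK : (1 <= K)%R) by (unfold K; lra).
  (* The distances and the perimeter are at most [K] times the size, and the
     boundary estimate contributes the factor 4. *)
  assert (Heps : (0 < eta / (4 * K * K))%R) by (apply Rdiv_lt_0_compat; nra).
  destruct (Hd _ Heps) as [d [Hd0 Hl]].
  exists (d / K)%R. split; [apply Rdiv_lt_0_compat; lra|].
  intros r1 r2 t1 t2 Hr Ht HrR Hr0 Ht0 HS.
  set (S := (r2 - r1 + (t2 - t1))%R) in *.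
  assert (HSd : (K * S < d)%R).
  { apply (Rmult_lt_compat_l K) in HS; [|lra].
    replace (K * (d / K))%R with d in HS by (field; lra). exact HS. }
  assert (Hdist : forall r t, (r1 <= r <= r2)%R -> (t1 <= t <= t2)%R ->
    (Cmod (polar r t - polar r0 t0) <= K * S)%R).
  { intros r t Hr' Ht'. eapply Rle_trans; [apply polar_lipschitz; lra|].
    assert (Rabs (r - r0) <= r2 - r1)%R by (apply Rabs_le; lra).
    assert (Rabs (t - t0) <= t2 - t1)%R by (apply Rabs_le; lra).
    assert (2 * r0 * Rabs (t - t0) <= 2 * R0 * (t2 - t1))%R.
    { apply Rmult_le_compat; try lra. apply Rabs_pos. }
    unfold K, S. nra. }
  set (z0 := polar r0 t0) in *.
  set (A := q z0 - l * z0).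
  set (rem := fun z => q z - (A + l * z)).
  assert (Caff : continuous_map (fun z => A + l * z)).
  { intros z. apply continuous_Cplus; [apply continuous_const|].
    apply continuous_Cmult; [apply continuous_const|apply continuous_id]. }
  assert (Crem : continuous_map rem) by (intros z; apply continuous_Cminus; [apply Hq|apply Caff]).
  assert (Eq : sector q r1 r2 t1 t2 = sector rem r1 r2 t1 t2).
  { transitivity (sector (fun z => rem z + (A + l * z)) r1 r2 t1 t2).
    - unfold rem. unfold sector, arc, ray.
      assert (E : forall z, q z = q z - (A + l * z) + (A + l * z)) by (intros; ring).
      f_equal; [f_equal|f_equal]; apply CInt_ext; intros; now rewrite <- E.
    - rewrite (sector_plus rem _ _ _ _ _ Crem Caff), sector_affine. ring. }
  rewrite Eq.
  eapply Rle_trans.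
  - apply (sector_bound rem r1 r2 t1 t2 (eta / (4 * K * K) * (K * S))%R Crem Hr Ht).
    intros r t Hr' Ht'. specialize (Hdist r t Hr' Ht').
    unfold rem, A.
    replace (q (polar r t) - (q z0 - l * z0 + l * polar r t)) with
      (q (polar r t) - q z0 - l * (polar r t - z0)) by ring.
    eapply Rle_trans; [apply Hl; lra|].
    apply Rmult_le_compat_l; lra.
  - assert (H1 : (r2 * (t2 - t1) + (r2 - r1) <= K * S)%R) by (unfold K, S; nra).
    assert (H0 : (0 <= S)%R) by (unfold S; lra).
    replace (4 * (eta / (4 * K * K) * (K * S)) * (r2 * (t2 - t1) + (r2 - r1)))%R
      with (eta * S / K * (r2 * (t2 - t1) + (r2 - r1)))%R by (field; lra).
    replace (eta * S ^ 2)%R with (eta * S / K * (K * S))%R by (field; lra).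
    apply Rmult_le_compat_l; [|exact H1].
    apply Rmult_le_pos; [nra|]. left. apply Rinv_0_lt_compat. lra.
Qed.

(** One of the four quarters carries at least a quarter of the integral. *)
Lemma sector_bisect (q : C -> C) (r t a b m : R) : continuous_map q ->
  (m < Cmod (sector q r (r + a) t (t + b)))%R ->
  exists r' t', (r' = r \/ r' = r + a / 2)%R /\ (t' = t \/ t' = t + b / 2)%R /\
    (m / 4 < Cmod (sector q r' (r' + a / 2) t' (t' + b / 2)))%R.
Proof.
  intros Hq H. apply NNPP. intros HN.
  assert (HL : forall r' t', (r' = r \/ r' = r + a / 2)%R -> (t' = t \/ t' = t + b / 2)%R ->
    (Cmod (sector q r' (r' + a / 2) t' (t' + b / 2)) <= m / 4)%R).
  { intros r' t' H1 H2. apply Rnot_lt_le. intros H3. apply HN. now exists r', t'. }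
  rewrite (sector_split q r (r + a / 2) (r + a) t (t + b / 2) (t + b) Hq) in H.
  assert (H1 := HL r t ltac:(auto) ltac:(auto)).
  assert (H2 := HL r (t + b / 2)%R ltac:(auto) ltac:(auto)).
  assert (H3 := HL (r + a / 2)%R t ltac:(auto) ltac:(auto)).
  assert (H4 := HL (r + a / 2)%R (t + b / 2)%R ltac:(auto) ltac:(auto)).
  replace (r + a / 2 + a / 2)%R with (r + a)%R in * by lra.
  replace (t + b / 2 + b / 2)%R with (t + b)%R in * by lra.
  revert H. apply Rle_not_lt.
  eapply Rle_trans; [apply Cmod_triangle|].
  eapply Rle_trans; [apply Rplus_le_compat; apply Cmod_triangle|]. lra.
Qed.

(** Goursat's argument: if the integral were nonzero, repeated bisection would
    produce nested sectors on which it is at least a fixed multiple of the square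
    of the size, against [small_sector] at their common point. *)
Lemma goursat_sector (q : C -> C) (r1 r2 t1 t2 : R) :
  continuous_map q -> (0 <= r1 <= r2)%R -> (t1 <= t2)%R ->
  (forall r t, (r1 <= r <= r2)%R -> (t1 <= t <= t2)%R -> exists l, is_Cderive q (polar r t) l) ->
  sector q r1 r2 t1 t2 = 0.
Proof.
  intros Hq Hr Ht Hd. apply NNPP. intros HN.
  apply Cmod_gt_0 in HN.
  set (a := (r2 - r1)%R). set (b := (t2 - t1)%R). set (S0 := (a + b)%R).
  assert (HS0 : (0 <= S0)%R) by (unfold S0, a, b; lra).
  (* The summand 1 makes the first inequality strict and covers a degenerate
     sector. *)
  set (eta := (Cmod (sector q r1 r2 t1 t2) / (S0 ^ 2 + 1))%R).
  assert (Heta : (0 < eta)%R) by (apply Rdiv_lt_0_compat; nra).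
  set (bad := fun n (p : R * R) => (eta * (S0 / 2 ^ n) ^ 2 <
     Cmod (sector q (fst p) (fst p + a / 2 ^ n) (snd p) (snd p + b / 2 ^ n)))%R).
  set (child := fun n (p p' : R * R) =>
     (fst p' = fst p \/ fst p' = fst p + a / 2 ^ S n)%R /\
     (snd p' = snd p \/ snd p' = snd p + b / 2 ^ S n)%R /\ (bad n p -> bad (S n) p')).
  assert (Hpow : forall n, (0 < 2 ^ n)%R) by (intros; apply pow_lt; lra).
  assert (Hhalf : forall x n, (x / 2 ^ S n = x / 2 ^ n / 2)%R).
  { intros x n. simpl. field. specialize (Hpow n). lra. }
  assert (Hchild : forall n p, exists p', child n p p').
  { intros n p. destruct (classic (bad n p)) as [Hb|Hb].
    - unfold bad in Hb. destruct (sector_bisect _ _ _ _ _ _ Hq Hb) as [r' [t' [H1 [H2 H3]]]].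
      exists (r', t'). unfold child, bad. cbn [fst snd]. rewrite !Hhalf. repeat split; auto.
      intros _. eapply Rle_lt_trans; [|exact H3]. right. field. specialize (Hpow n). lra.
    - exists p. repeat split; auto. tauto. }
  set (corner := fix corner n := match n with
     | O => (r1, t1)
     | S n => proj1_sig (constructive_indefinite_description _ (Hchild n (corner n))) end).
  assert (Hcorner : forall n, child n (corner n) (corner (S n))).
  { intros n. simpl. now destruct constructive_indefinite_description. }
  assert (Hbad : forall n, bad n (corner n)).
  { induction n as [|n IH]; [|now apply (Hcorner n)].
    unfold bad. change (corner O) with (r1, t1). cbn [fst snd pow].
    rewrite !Rdiv_1_r.
    replace (r1 + a)%R with r2 by (unfold a; lra).
    replace (t1 + b)%R with t2 by (unfold b; lra).
    apply Rlt_le_trans with (eta * (S0 ^ 2 + 1))%R; [simpl; nra|].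
    right. unfold eta. field. nra. }
  assert (Ha : (0 <= a)%R) by (unfold a; lra). assert (Hb : (0 <= b)%R) by (unfold b; lra).
  assert (Hdiv : forall x n, (0 <= x)%R -> (0 <= x / 2 ^ n)%R).
  { intros x n Hx. apply Rmult_le_pos; [exact Hx|]. left. apply Rinv_0_lt_compat, Hpow. }
  destruct (nested_intervals (fun n => fst (corner n)) (fun n => (fst (corner n) + a / 2 ^ n)%R))
    as [r0 Hr0].
  { intros n. destruct (Hcorner n) as [H _]. specialize (Hdiv a (S n) Ha). lra. }
  { intros n. destruct (Hcorner n) as [H _]. assert (E := Hhalf a n).
    specialize (Hdiv a (S n) Ha). lra. }
  { intros n. specialize (Hdiv a n Ha). lra. }
  destruct (nested_intervals (fun n => snd (corner n)) (fun n => (snd (corner n) + b / 2 ^ n)%R))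
    as [t0 Ht0].
  { intros n. destruct (Hcorner n) as [_ [H _]]. specialize (Hdiv b (S n) Hb). lra. }
  { intros n. destruct (Hcorner n) as [_ [H _]]. assert (E := Hhalf b n).
    specialize (Hdiv b (S n) Hb). lra. }
  { intros n. specialize (Hdiv b n Hb). lra. }
  cbv beta in Hr0, Ht0.
  assert (Hin : forall n, (r1 <= fst (corner n) /\ fst (corner n) + a / 2 ^ n <= r2)%R).
  { induction n as [|n IH].
    - simpl. unfold a. lra.
    - destruct (Hcorner n) as [H _]. assert (E := Hhalf a n).
      specialize (Hdiv a (S n) Ha). lra. }
  destruct (Hd r0 t0) as [l Hl].
  { specialize (Hr0 O). simpl in Hr0. unfold a in Hr0. lra. }
  { specialize (Ht0 O). simpl in Ht0. unfold b in Ht0. lra. }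
  destruct (small_sector q r0 t0 r2 eta l Hq Heta Hl) as [d [Hd0 Hsmall]].
  destruct (pow_lt_1_zero (1 / 2)%R ltac:(rewrite Rabs_pos_eq; lra) (d / (S0 + 1))%R
    ltac:(apply Rdiv_lt_0_compat; lra)) as [n Hn].
  specialize (Hn n (le_n n)).
  assert (Hpn : ((1 / 2) ^ n = / 2 ^ n)%R).
  { unfold Rdiv. rewrite Rmult_1_l. apply pow_inv. }
  rewrite Hpn in Hn. rewrite Rabs_pos_eq in Hn by (left; apply Rinv_0_lt_compat, Hpow).
  assert (HSn : (S0 / 2 ^ n < d)%R).
  { unfold Rdiv at 1. apply Rle_lt_trans with ((S0 + 1) * / 2 ^ n)%R.
    - apply Rmult_le_compat_r; [|lra]. left. apply Rinv_0_lt_compat, Hpow.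
    - apply (Rmult_lt_compat_l (S0 + 1)) in Hn; [|lra].
      replace ((S0 + 1) * (d / (S0 + 1)))%R with d in Hn by (field; lra). exact Hn. }
  specialize (Hbad n). unfold bad in Hbad. revert Hbad. apply Rle_not_lt.
  specialize (Hr0 n). specialize (Ht0 n). specialize (Hin n).
  assert (ES : (fst (corner n) + a / 2 ^ n - fst (corner n) +
     (snd (corner n) + b / 2 ^ n - snd (corner n)) = S0 / 2 ^ n)%R).
  { unfold S0. field. specialize (Hpow n). lra. }
  rewrite <- ES. apply Hsmall; lra.
Qed.

(** * Circles: the Cauchy theorem and the Cauchy formula *)

Lemma unit_vec_2PI : unit_vec (2 * PI) = unit_vec 0.
Proof. unfold unit_vec. now rewrite cos_2PI, sin_2PI, cos_0, sin_0. Qed.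

(** The full annulus is a sector whose two radial edges coincide and cancel. *)
Lemma arc_annulus (q : C -> C) (r1 r2 : R) : continuous_map q -> (0 <= r1 <= r2)%R ->
  (forall z, (r1 <= Cmod z <= r2)%R -> exists l, is_Cderive q z l) ->
  arc q r1 0 (2 * PI) = arc q r2 0 (2 * PI).
Proof.
  intros Hq Hr Hd. assert (P := PI_RGT_0).
  assert (H := goursat_sector q r1 r2 0 (2 * PI) Hq Hr ltac:(lra)).
  unfold sector in H.
  assert (E : ray q (2 * PI) r1 r2 = ray q 0 r1 r2).
  { apply CInt_ext. intros r. unfold polar. now rewrite unit_vec_2PI. }
  rewrite E in H.
  symmetry. apply Ceq_minus.
  rewrite <- H.
  - ring.
  - intros r t Hr' _. apply Hd. rewrite Cmod_polar; lra.
Qed.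

(** Uniform continuity of the integrand in radius and angle together. *)
Lemma arc_continuous (q : C -> C) (r0 : R) : continuous_map q ->
  forall e, (0 < e)%R -> exists d, (0 < d)%R /\ forall r, (Rabs (r - r0) < d)%R ->
  (Cmod (arc q r 0 (2 * PI) - arc q r0 0 (2 * PI)) <= e)%R.
Proof.
  intros Hq e He. assert (HP := PI_RGT_0).
  set (k := fun p : R * R => q (polar (fst p) (snd p)) * (Ci * polar (fst p) (snd p))).
  assert (Hk : forall p, continuous k p).
  { assert (Hp : forall p, continuous (fun p : R * R => polar (fst p) (snd p)) p).
    { intros [r t]. apply continuous_Cmult.
      - apply continuous_RtoC, continuous_fst.
      - apply (continuous_comp snd unit_vec); [apply continuous_snd|apply unit_vec_continuous]. }
    intros p. apply continuous_Cmult.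
    - apply (continuous_comp (fun p : R * R => polar (fst p) (snd p)) q); auto.
    - apply continuous_Cmult; [apply continuous_const|auto]. }
  assert (He8 : (0 < e / (8 * PI))%R) by (apply Rdiv_lt_0_compat; lra).
  assert (Hre : forall t, continuity_2d_pt (fun r t => fst (k (r, t))) r0 t).
  { intros t. apply continuity_2d_pt_filterlim.
    refine (filterlim_ext _ _ _ (continuous_re k (r0, t) (Hk _))). now intros []. }
  assert (Him : forall t, continuity_2d_pt (fun r t => snd (k (r, t))) r0 t).
  { intros t. apply continuity_2d_pt_filterlim.
    refine (filterlim_ext _ _ _ (continuous_im k (r0, t) (Hk _))). now intros []. }
  destruct (uniform_continuity_2d_1d' _ 0 (2 * PI) r0 (fun t _ => Hre t)
    (mkposreal _ He8)) as [d1 H1].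
  destruct (uniform_continuity_2d_1d' _ 0 (2 * PI) r0 (fun t _ => Him t)
    (mkposreal _ He8)) as [d2 H2].
  exists (Rmin d1 d2). split; [apply Rmin_glb_lt; apply cond_pos|].
  intros r Hr. assert (M1 := Rmin_l d1 d2). assert (M2 := Rmin_r d1 d2).
  assert (P1 := cond_pos d1). assert (P2 := cond_pos d2).
  apply Rabs_def2 in Hr.
  unfold arc. rewrite <- (CInt_minus _ _ _ _ (arc_integrand_continuous q r Hq)
    (arc_integrand_continuous q r0 Hq)).
  apply Rle_trans with (2 * (2 * (e / (8 * PI))) * (2 * PI - 0))%R; [|right; field; lra].
  apply CInt_bound; [lra| |].
  { intros t. apply continuous_Cminus; now apply arc_integrand_continuous. }
  intros t Ht. eapply Rle_trans; [apply Cmod_le_parts|].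
  assert (B1 : (Rabs (fst (k (r, t)) - fst (k (r0, t))) < e / (8 * PI))%R).
  { apply H1; try lra. unfold Rminus. now rewrite Rplus_opp_r, Rabs_R0. }
  assert (B2 : (Rabs (snd (k (r, t)) - snd (k (r0, t))) < e / (8 * PI))%R).
  { apply H2; try lra. unfold Rminus. now rewrite Rplus_opp_r, Rabs_R0. }
  apply Rlt_le. replace (2 * (e / (8 * PI)))%R with (e / (8 * PI) + e / (8 * PI))%R by ring.
  apply Rplus_lt_compat; [exact B1|exact B2].
Qed.

Lemma arc_zero_radius (q : C -> C) (a b : R) : continuous_map q -> arc q 0 a b = 0.
Proof.
  intros Hq. unfold arc.
  rewrite (CInt_ext _ (fun t => 0 * (q (polar 0 t) * (Ci * polar 0 t)))).
  - rewrite CInt_scal by now apply arc_integrand_continuous. ring.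
  - intros t. unfold polar. ring.
Qed.

Lemma eq_0_of_Cmod_le (z : C) : (forall e, (0 < e)%R -> (Cmod z <= e)%R) -> z = 0.
Proof.
  intros H. apply Cmod_eq_0. apply Rle_antisym; [|apply Cmod_ge_0].
  apply le_epsilon. intros e He. rewrite Rplus_0_l. auto.
Qed.

(** Only one circle about the origin meets the exceptional point [w].  Inside it
    the integral is constant, hence equal to its value 0 at radius 0; continuity
    in the radius carries the value 0 onto that circle and then past it. *)
Lemma circle_integral_zero (q : C -> C) (w : C) (r : R) : continuous_map q ->
  (forall z, z <> w -> exists l, is_Cderive q z l) -> (0 <= r)%R ->
  arc q r 0 (2 * PI) = 0.
Proof.
  intros Hq Hd Hr. assert (Hw := Cmod_ge_0 w).
  assert (Hin : forall s, (0 <= s < Cmod w)%R -> arc q s 0 (2 * PI) = 0).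
  { intros s Hs. rewrite <- (arc_annulus q 0 s Hq ltac:(lra)).
    - now apply arc_zero_radius.
    - intros z Hz. apply Hd. intros ->. lra. }
  assert (Hon : arc q (Cmod w) 0 (2 * PI) = 0).
  { destruct (Req_dec (Cmod w) 0) as [->|Hn]; [now apply arc_zero_radius|].
    apply eq_0_of_Cmod_le. intros e He.
    destruct (arc_continuous q (Cmod w) Hq e He) as [d [Hd0 H]].
    set (s := Rmax 0 (Cmod w - d / 2)).
    assert (Hs : (0 <= s < Cmod w)%R).
    { unfold s. split; [apply Rmax_l|apply Rmax_lub_lt; lra]. }
    specialize (H s). rewrite Hin in H by exact Hs.
    replace (0 - arc q (Cmod w) 0 (2 * PI)) with (- arc q (Cmod w) 0 (2 * PI)) in H by ring.
    rewrite Cmod_opp in H. apply H. apply Rabs_def1; [lra|].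
    assert (Cmod w - d / 2 <= s)%R by apply Rmax_r. lra. }
  destruct (Rtotal_order r (Cmod w)) as [Hl|[->|Hg]]; [now apply Hin|exact Hon|].
  apply eq_0_of_Cmod_le. intros e He.
  destruct (arc_continuous q (Cmod w) Hq e He) as [d [Hd0 H]].
  set (s := Rmin r (Cmod w + d / 2)).
  assert (Hs : (Cmod w < s <= r)%R).
  { unfold s. split; [apply Rmin_glb_lt; lra|apply Rmin_l]. }
  specialize (H s). rewrite Hon in H.
  rewrite <- (arc_annulus q s r Hq ltac:(lra)).
  2:{ intros z Hz. apply Hd. intros ->. lra. }
  replace (arc q s 0 (2 * PI) - 0) with (arc q s 0 (2 * PI)) in H by ring.
  apply H. apply Rabs_def1; [|lra].
  assert (s <= Cmod w + d / 2)%R by apply Rmin_r. lra.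
Qed.

(** The integral against the [n]-th remainder of the geometric expansion of the
    Cauchy kernel [1 / (z - w)] in powers of [w / z].  With [n = 0] it is, up to
    normalization, the Cauchy integral of [h]. *)
Definition kernel_integral (h : C -> C) (r : R) (n : nat) (w : C) : C :=
  CInt (fun t => h (polar r t) * (w / polar r t) ^ n * (polar r t / (polar r t - w))) 0 (2 * PI).

Lemma polar_neq (r t : R) (w : C) : (Cmod w < r)%R -> polar r t - w <> 0.
Proof.
  intros H E. apply Ceq_minus in E.
  assert (P : (0 <= r)%R) by (assert (P := Cmod_ge_0 w); lra).
  rewrite <- E, Cmod_polar in H; lra.
Qed.

Lemma polar_neq_0 (r t : R) : (0 < r)%R -> polar r t <> 0.
Proof.
  intros H E. assert (G := Cmod_polar r t ltac:(lra)). rewrite E, Cmod_0 in G. lra.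
Qed.

Lemma kernel_continuous (h : C -> C) (r : R) (n : nat) (w : C) :
  continuous_map h -> (Cmod w < r)%R ->
  continuous_path (fun t => h (polar r t) * (w / polar r t) ^ n * (polar r t / (polar r t - w))).
Proof.
  intros Hh Hw t. assert (P := Cmod_ge_0 w).
  assert (Cp := polar_continuous_angle r t).
  apply continuous_Cmult; [apply continuous_Cmult|apply continuous_Cmult].
  - apply (continuous_comp (polar r) h); auto.
  - apply (continuous_Cpow (fun t => w / polar r t)).
    apply continuous_Cmult; [apply continuous_const|].
    apply continuous_Cinv; [apply polar_neq_0; lra|exact Cp].
  - exact Cp.
  - apply (continuous_Cinv (fun t => polar r t - w)); [now apply polar_neq|].
    apply continuous_Cminus; [exact Cp|apply continuous_const].
Qed.

Lemma continuous_map_const (c : C) : continuous_map (fun _ => c).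
Proof. intros z. apply continuous_const. Qed.

(** The divided difference of [h] at [w] is continuous and differentiable off [w],
    so its integral around the circle vanishes.  The factor on the left is the
    normalizing integral, which would be [2 * PI]. *)
Lemma cauchy_formula (h : C -> C) (r : R) (w : C) : entire h -> (Cmod w < r)%R ->
  kernel_integral (fun _ => 1) r 0 w * h w = kernel_integral h r 0 w.
Proof.
  intros Hh Hw. assert (P := Cmod_ge_0 w).
  destruct (proj1 (entire_Cderive h) Hh w) as [l Hl].
  set (q := divided_difference h w l).
  assert (Hq : continuous_map q) by (intros z; now apply divided_difference_continuous).
  assert (Hz : arc q r 0 (2 * PI) = 0).
  { apply (circle_integral_zero q w r Hq); [|lra]. now apply divided_difference_derivable. }
  assert (Hc : continuous_map h) by (intros z; now apply entire_continuous).
  assert (C1 := kernel_continuous (fun _ => 1) r 0 w (continuous_map_const 1) Hw).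
  unfold kernel_integral.
  rewrite Cmult_comm, <- CInt_scal by exact C1.
  symmetry. apply Ceq_minus.
  rewrite <- CInt_minus.
  2: now apply kernel_continuous.
  2:{ intros t. apply continuous_Cmult; [apply continuous_const|apply C1]. }
  transitivity (- Ci * arc q r 0 (2 * PI)); [|rewrite Hz; ring].
  unfold arc. rewrite <- CInt_scal by now apply arc_integrand_continuous.
  apply CInt_ext. intros t.
  assert (Hn := polar_neq r t w Hw).
  unfold q, divided_difference. destruct (Ceq_dec (polar r t) w) as [E|E].
  { exfalso. apply Hn. rewrite E. ring. }
  simpl.
  replace (- Ci * ((h (polar r t) - h w) / (polar r t - w) * (Ci * polar r t)))
    with (- (Ci * Ci) * ((h (polar r t) - h w) / (polar r t - w) * polar r t)) by ring.
  replace (- (Ci * Ci)) with (RtoC 1) by (apply injective_projections; simpl; ring).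
  field. exact Hn.
Qed.

(** One step of Taylor expansion: the integral on the right is the [n]-th Taylor
    coefficient up to the factor [2 * PI]. *)
Lemma kernel_integral_step (h : C -> C) (r : R) (n : nat) (w : C) : continuous_map h ->
  (Cmod w < r)%R ->
  kernel_integral h r n w =
  w ^ n * CInt (fun t => h (polar r t) * (/ polar r t) ^ n) 0 (2 * PI) +
  kernel_integral h r (S n) w.
Proof.
  intros Hh Hw. assert (P := Cmod_ge_0 w).
  assert (Cc : continuous_path (fun t => h (polar r t) * (/ polar r t) ^ n)).
  { intros t. assert (Cp := polar_continuous_angle r t). apply continuous_Cmult.
    - apply (continuous_comp (polar r) h); auto.
    - apply continuous_Cpow, continuous_Cinv; [apply polar_neq_0; lra|exact Cp]. }
  unfold kernel_integral. rewrite <- CInt_scal by exact Cc. rewrite <- CInt_plus.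
  2:{ intros t. apply continuous_Cmult; [apply continuous_const|apply Cc]. }
  2: now apply kernel_continuous.
  apply CInt_ext. intros t. unfold Cdiv. rewrite Cpow_S, Cpow_mult_l. field.
  split; [now apply polar_neq|apply polar_neq_0; lra].
Qed.

Lemma kernel_integral_bound (h : C -> C) (r M : R) (n : nat) (w : C) : continuous_map h ->
  (0 < r)%R -> (Cmod w <= r / 8)%R -> 
  (forall t, (0 <= t <= 2 * PI)%R -> (Cmod (h (polar r t)) <= M)%R) ->
  (Cmod (kernel_integral h r n w) <= 8 * PI * M * (Cmod w / r) ^ n)%R.
Proof.
  intros Hh Hr Hw HM. assert (HP := PI_RGT_0). assert (P := Cmod_ge_0 w).
  apply Rle_trans with (2 * (2 * M * (Cmod w / r) ^ n) * (2 * PI - 0))%R; [|right; ring].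
  apply CInt_bound; [lra|apply kernel_continuous; [exact Hh|lra]|].
  intros t Ht.
  assert (Hn := polar_neq r t w ltac:(lra)). assert (Hn0 := polar_neq_0 r t Hr).
  rewrite !Cmod_mult, Cmod_pow, !Cmod_div, Cmod_polar by (auto; lra).
  assert (Hp : (0 <= (Cmod w / r) ^ n)%R).
  { apply pow_le, Rmult_le_pos; [exact P|]. left. now apply Rinv_0_lt_compat. }
  assert (HMt : (Cmod (h (polar r t)) <= M)%R) by (apply HM; lra).
  assert (P2 := Cmod_ge_0 (h (polar r t))).
  assert (Hden : (r / 2 <= Cmod (polar r t - w))%R).
  { assert (H := Cmod_sub_lower (polar r t) w). rewrite Cmod_polar in H; lra. }
  assert (Hk : (0 <= r / Cmod (polar r t - w) <= 2)%R).
  { split.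
    - apply Rmult_le_pos; [lra|]. left. apply Rinv_0_lt_compat. lra.
    - apply (Rmult_le_reg_r (Cmod (polar r t - w))); [lra|].
      unfold Rdiv. rewrite Rmult_assoc, Rinv_l; lra. }
  replace (2 * M * (Cmod w / r) ^ n)%R with (M * (Cmod w / r) ^ n * 2)%R by ring.
  apply Rmult_le_compat; try lra; [now apply Rmult_le_pos|].
  now apply Rmult_le_compat_r.
Qed.

(** Enough of the value [2 * PI] of the normalizing integral to divide by it. *)
Lemma kernel_lower (r : R) (w : C) : (0 < r)%R -> (Cmod w <= r / 8)%R ->
  (1 <= Cmod (kernel_integral (fun _ => 1) r 0 w))%R.
Proof.
  intros Hr Hw. assert (HP := PI2_1). assert (P := Cmod_ge_0 w).
  rewrite kernel_integral_step; [|apply continuous_map_const|lra].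
  assert (B := kernel_integral_bound (fun _ => 1) r 1 1 w (continuous_map_const 1) Hr Hw).
  rewrite (CInt_ext _ (fun _ => 1)) by (intros; simpl; ring).
  replace (CInt (fun _ => RtoC 1) 0 (2 * PI)) with (RtoC (2 * PI)).
  2:{ apply injective_projections; simpl; rewrite RInt_const;
      unfold scal; simpl; unfold mult; simpl; ring. }
  assert (B' := B ltac:(intros; cbv beta; rewrite Cmod_1; lra)). clear B.
  set (X := kernel_integral _ r 1 w) in *.
  assert (T := Cmod_sub_lower (w ^ 0 * RtoC (2 * PI)) (- X)).
  replace (w ^ 0 * RtoC (2 * PI) - - X) with (w ^ 0 * RtoC (2 * PI) + X) in T by ring.
  rewrite Cmod_opp in T.
  replace (Cmod (w ^ 0 * RtoC (2 * PI))) with (2 * PI)%R in T.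
  2:{ simpl. rewrite Cmult_1_l, Cmod_R, Rabs_pos_eq; lra. }
  assert (Hq : (Cmod w / r <= 1 / 8)%R).
  { apply (Rmult_le_reg_r r); [exact Hr|]. unfold Rdiv at 1. rewrite Rmult_assoc, Rinv_l; lra. }
  simpl pow in B'.
  assert (8 * PI * 1 * (Cmod w / r * 1) <= 8 * PI * (1 / 8))%R.
  { rewrite !Rmult_1_r. apply Rmult_le_compat_l; lra. }
  lra.
Qed.

(** * Liouville, density of the range, order of vanishing *)

Lemma circle_bounded (h : C -> C) (r : R) : continuous_map h ->
  exists M, (0 <= M)%R /\ forall t, (0 <= t <= 2 * PI)%R -> (Cmod (h (polar r t)) <= M)%R.
Proof.
  intros Hh. assert (HP := PI_RGT_0).
  assert (Cu : continuous_path (fun t => h (polar r t))).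
  { intros t. apply (continuous_comp (polar r) h); [apply polar_continuous_angle|apply Hh]. }
  destruct (bounded_continuity (V := R_NormedModule) (fun t => fst (h (polar r t))) 0 (2 * PI)
    ltac:(intros t _; apply (continuous_re _ t (Cu t)))) as [M1 H1].
  destruct (bounded_continuity (V := R_NormedModule) (fun t => snd (h (polar r t))) 0 (2 * PI)
    ltac:(intros t _; apply (continuous_im _ t (Cu t)))) as [M2 H2].
  assert (B : forall t, (0 <= t <= 2 * PI)%R -> (Cmod (h (polar r t)) <= M1 + M2)%R).
  { intros t Ht. eapply Rle_trans; [apply Cmod_le_parts|].
    apply Rplus_le_compat; apply Rlt_le; [apply (H1 t Ht)|apply (H2 t Ht)]. }
  exists (M1 + M2)%R. split; [|exact B].
  eapply Rle_trans; [apply Cmod_ge_0|apply (B 0%R); lra].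
Qed.

Lemma cauchy_formula_le (h : C -> C) (r : R) (w : C) : entire h -> (0 < r)%R ->
  (Cmod w <= r / 8)%R -> (Cmod (h w) <= Cmod (kernel_integral h r 0 w))%R.
Proof.
  intros Hh Hr Hw. rewrite <- cauchy_formula by (auto; lra).
  rewrite Cmod_mult. assert (L := kernel_lower r w Hr Hw). assert (P := Cmod_ge_0 (h w)).
  nra.
Qed.

Lemma entire_minus_const (h : C -> C) (c : C) : entire h -> entire (fun z => h z - c).
Proof.
  rewrite !entire_Cderive. intros H z. destruct (H z) as [l Hl]. exists l.
  now apply is_Cderive_minus_const.
Qed.

(** For [k = h - h 0] the constant term of the expansion vanishes, so [k w] is
    bounded by the remainder of order 1, which is of the order of [|w| / r]. *)
Lemma liouville (h : C -> C) (M : R) : entire h ->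
  (forall z, (Cmod (h z) <= M)%R) -> forall z, h z = h 0.
Proof.
  intros Hh HM w. apply Ceq_minus.
  set (k := fun z => h z - h 0). change (k w = 0).
  assert (Hk : entire k) by now apply entire_minus_const.
  assert (Ck := entire_continuous k Hk).
  assert (HkM : forall z, (Cmod (k z) <= 2 * M)%R).
  { intros z. unfold k. assert (T := Cmod_triangle (h z) (- h 0)).
    rewrite Cmod_opp in T. change (h z + - h 0) with (h z - h 0) in T.
    assert (A := HM z). assert (B := HM 0). lra. }
  assert (HP := PI_RGT_0). assert (P := Cmod_ge_0 w).
  assert (M0 : (0 <= M)%R) by (eapply Rle_trans; [apply Cmod_ge_0|apply (HM 0)]).
  assert (Hk0 : k 0 = 0) by (unfold k; ring).
  assert (Key : forall r, (0 < r)%R -> (Cmod w <= r / 8)%R ->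
    (Cmod (k w) <= 8 * PI * (2 * M) * (Cmod w / r))%R).
  { intros r Hr Hw. eapply Rle_trans; [now apply (cauchy_formula_le k r w)|].
    assert (Hc0 : CInt (fun t => k (polar r t) * (/ polar r t) ^ 0) 0 (2 * PI) = 0).
    { assert (F := cauchy_formula k r 0 Hk ltac:(rewrite Cmod_0; lra)).
      rewrite Hk0, Cmult_0_r, kernel_integral_step in F by (auto; rewrite Cmod_0; lra).
      assert (B := kernel_integral_bound k r (2 * M) 1 0 Ck Hr
        ltac:(rewrite Cmod_0; lra) ltac:(auto)).
      rewrite Cmod_0 in B. replace (0 / r)%R with 0%R in B by (field; lra).
      simpl pow in B. rewrite Rmult_0_l, Rmult_0_r in B.
      assert (E : kernel_integral k r 1 0 = 0).
      { apply Cmod_eq_0. apply Rle_antisym; [exact B|apply Cmod_ge_0]. }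
      rewrite E in F. rewrite Cplus_0_r in F. simpl in F. rewrite Cmult_1_l in F.
      now rewrite F. }
    rewrite kernel_integral_step by (auto; lra). rewrite Hc0, Cmult_0_r, Cplus_0_l.
    rewrite <- (pow_1 (Cmod w / r)). apply kernel_integral_bound; auto. }
  apply eq_0_of_Cmod_le. intros e He.
  (* The first two summands put [w] well inside the circle; the last one makes
     the bound of [Key] at most [e]. *)
  set (r := (8 * Cmod w + 1 + 16 * PI * M * Cmod w / e)%R).
  assert (X : (0 <= 16 * PI * M * Cmod w)%R) by
    (apply Rmult_le_pos; [apply Rmult_le_pos|]; lra).
  assert (Y : (0 <= 16 * PI * M * Cmod w / e)%R).
  { apply Rmult_le_pos; [exact X|]. left. now apply Rinv_0_lt_compat. }
  assert (Hr : (0 < r)%R) by (unfold r; lra).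
  eapply Rle_trans; [apply (Key r Hr); unfold r; lra|].
  apply (Rmult_le_reg_r r); [exact Hr|].
  replace (8 * PI * (2 * M) * (Cmod w / r) * r)%R with (16 * PI * M * Cmod w)%R by (field; lra).
  unfold r. rewrite Rmult_plus_distr_l.
  replace (e * (16 * PI * M * Cmod w / e))%R with (16 * PI * M * Cmod w)%R by (field; lra).
  assert (0 <= e * (8 * Cmod w + 1))%R by (apply Rmult_le_pos; lra). lra.
Qed.

Definition constant_map (h : C -> C) : Prop := exists c, forall z, h z = c.

Definition dense_range (h : C -> C) : Prop :=
  forall w e, (0 < e)%R -> exists z, (Cmod (h z - w) < e)%R.

(** If the values of [h] stayed away from [w], then [1 / (h - w)] would be bounded
    and entire. *)
Lemma entire_dense_range (h : C -> C) : entire h -> ~ constant_map h -> dense_range h.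
Proof.
  intros Hh Hn w e He. apply NNPP. intros HN.
  assert (Hfar : forall z, (e <= Cmod (h z - w))%R).
  { intros z. apply Rnot_lt_le. intros H. apply HN. now exists z. }
  assert (Hnz : forall z, h z - w <> 0).
  { intros z E. specialize (Hfar z). rewrite E, Cmod_0 in Hfar. lra. }
  assert (Hk : entire (fun z => / (h z - w))).
  { apply entire_Cderive. intros z.
    destruct (proj1 (entire_Cderive h) Hh z) as [l Hl]. eexists.
    apply (is_Cderive_inv (fun z => h z - w)); [apply Hnz|]. apply is_Cderive_minus_const, Hl. }
  assert (L := liouville _ (/ e) Hk).
  apply Hn. exists (h 0). intros z.
  assert (E : / (h z - w) = / (h 0 - w)).
  { apply L. intros y. rewrite Cmod_inv by apply Hnz.
    apply Rinv_le_contravar; [exact He|apply Hfar]. }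
  replace (h z) with (/ / (h z - w) + w) by (field; apply Hnz).
  rewrite E. field. apply Hnz.
Qed.

(** On a circle so large that [w1] is well inside, the Taylor coefficients cannot
    all vanish, since the remainders at [w1] tend to zero.  The first nonzero
    term then dominates near the origin. *)
Lemma zero_lower_bound (k : C -> C) (w1 : C) : entire k -> k w1 <> 0 ->
  exists (N : nat) (c d : R), (0 < c)%R /\ (0 < d)%R /\
  forall w, (Cmod w < d)%R -> (c * Cmod w ^ N <= Cmod (k w))%R.
Proof.
  intros Hk Hn. assert (Ck := entire_continuous k Hk).
  assert (HP := PI_RGT_0). assert (P1 := Cmod_ge_0 w1).
  set (r := (8 * Cmod w1 + 1)%R). assert (Hr : (0 < r)%R) by (unfold r; lra).
  destruct (circle_bounded k r Ck) as [M [HM0 HM]].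
  set (c := fun n => CInt (fun t => k (polar r t) * (/ polar r t) ^ n) 0 (2 * PI)).
  assert (Red : forall n w, (Cmod w <= r / 8)%R -> (forall m, (m < n)%nat -> c m = 0) ->
    kernel_integral k r 0 w = kernel_integral k r n w).
  { intros n w Hw. induction n as [|n IH]; intros H; [reflexivity|].
    rewrite IH by (intros; apply H; lia).
    rewrite kernel_integral_step by (auto; lra). fold (c n). rewrite H by lia. ring. }
  (* If all coefficients vanished, [k w1] would be bounded by every remainder. *)
  assert (Hex : exists n, c n <> 0).
  { apply NNPP. intros HN.
    assert (Hc : forall n, c n = 0).
    { intros n. apply NNPP. intros H. apply HN. now exists n. }
    apply Hn. apply eq_0_of_Cmod_le. intros e He.
    assert (Hw1 : (Cmod w1 <= r / 8)%R) by (unfold r; lra).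
    assert (Hq : (0 <= Cmod w1 / r < 1)%R).
    { split.
      - apply Rmult_le_pos; [exact P1|]. left. now apply Rinv_0_lt_compat.
      - apply (Rmult_lt_reg_r r); [exact Hr|]. unfold Rdiv. rewrite Rmult_assoc, Rinv_l; lra. }
    destruct (pow_lt_1_zero (Cmod w1 / r) ltac:(rewrite Rabs_pos_eq; lra)
      (e / (8 * PI * M + 1))%R) as [n H].
    { apply Rdiv_lt_0_compat; [exact He|]. nra. }
    specialize (H n (le_n n)).
    assert (Hp : (0 <= (Cmod w1 / r) ^ n)%R) by (apply pow_le; lra).
    rewrite Rabs_pos_eq in H by exact Hp.
    eapply Rle_trans; [apply (cauchy_formula_le k r w1); auto|].
    rewrite (Red n w1) by auto.
    eapply Rle_trans; [apply (kernel_integral_bound k r M n w1); auto|].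
    assert (HB : (0 <= 8 * PI * M)%R) by (apply Rmult_le_pos; lra).
    apply Rle_trans with ((8 * PI * M + 1) * (e / (8 * PI * M + 1)))%R; [|right; field; lra].
    apply Rmult_le_compat; lra. }
  assert (Hmin : exists N, c N <> 0 /\ forall m, (m < N)%nat -> c m = 0).
  { destruct Hex as [n Hcn]. induction n as [n IH] using lt_wf_ind.
    destruct (classic (exists m, (m < n)%nat /\ c m <> 0)) as [[m [Hm Hcm]]|HN].
    - now apply (IH m).
    - exists n. split; [exact Hcn|]. intros m Hm. apply NNPP. intros H. apply HN. now exists m. }
  destruct Hmin as [N [HcN Hlow]].
  assert (HcN' : (0 < Cmod (c N))%R) by now apply Cmod_gt_0.
  assert (HrN : (0 < r ^ S N)%R) by now apply pow_lt.
  assert (HB : (0 <= 8 * PI * M)%R) by (apply Rmult_le_pos; lra).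
  
  (* Within [d] the remainder is at most half of the leading term; [8 * PI] bounds
     the normalizing integral from above, whence the constant [16 * PI]. *)
  set (d := Rmin (r / 8) (Cmod (c N) * r ^ S N / (2 * (8 * PI * M) + 1))).
  exists N, (Cmod (c N) / (16 * PI))%R, d. split; [|split].
  - apply Rdiv_lt_0_compat; lra.
  - apply Rmin_glb_lt; [lra|]. apply Rdiv_lt_0_compat; [|lra]. now apply Rmult_lt_0_compat.
  - intros w Hw. assert (P := Cmod_ge_0 w).
    assert (Hw8 : (Cmod w <= r / 8)%R).
    { apply Rlt_le, Rlt_le_trans with d; [exact Hw|apply Rmin_l]. }
    assert (Hwd : (Cmod w <= Cmod (c N) * r ^ S N / (2 * (8 * PI * M) + 1))%R).
    { apply Rlt_le, Rlt_le_trans with d; [exact Hw|apply Rmin_r]. }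
    assert (F := cauchy_formula k r w Hk ltac:(lra)).
    rewrite (Red N w Hw8 Hlow), (kernel_integral_step k r N w) in F by (auto; lra).
    fold (c N) in F.
    assert (B1 := kernel_integral_bound (fun _ => 1) r 1 0 w (continuous_map_const 1) Hr Hw8
      ltac:(intros; cbv beta; rewrite Cmod_1; lra)).
    assert (B2 := kernel_integral_bound k r M (S N) w Ck Hr Hw8 HM).
    set (kap := kernel_integral (fun _ => 1) r 0 w) in *.
    set (K := kernel_integral k r (S N) w) in *.
    assert (T := Cmod_triangle (w ^ N * c N + K) (- K)).
    replace (w ^ N * c N + K + - K) with (w ^ N * c N) in T by ring.
    rewrite <- F, Cmod_opp, !Cmod_mult, Cmod_pow in T. simpl pow in B1.
    assert (Pk := Cmod_ge_0 (k w)).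
    assert (B1' : (Cmod kap * Cmod (k w) <= 8 * PI * Cmod (k w))%R).
    { apply Rmult_le_compat_r; lra. }
    assert (HwN : (0 <= Cmod w ^ N)%R) by now apply pow_le.
    assert (B2' : (Cmod K <= Cmod w ^ N * (Cmod (c N) / 2))%R).
    { eapply Rle_trans; [exact B2|].
      replace ((Cmod w / r) ^ S N)%R with (Cmod w ^ N * (Cmod w * / r ^ S N))%R.
      2:{ unfold Rdiv. rewrite Rpow_mult_distr, pow_inv. simpl. ring. }
      replace (8 * PI * M * (Cmod w ^ N * (Cmod w * / r ^ S N)))%R with
        (Cmod w ^ N * (8 * PI * M * Cmod w * / r ^ S N))%R by ring.
      apply Rmult_le_compat_l; [exact HwN|].
      apply (Rmult_le_reg_r (r ^ S N)); [exact HrN|].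
      rewrite Rmult_assoc, Rinv_l, Rmult_1_r by lra.
      apply (Rmult_le_compat_l (2 * (8 * PI * M) + 1)) in Hwd; [|lra].
      replace ((2 * (8 * PI * M) + 1) * (Cmod (c N) * r ^ S N / (2 * (8 * PI * M) + 1)))%R
        with (Cmod (c N) * r ^ S N)%R in Hwd by (field; lra).
      assert (0 <= Cmod w)%R by exact P. nra. }
    apply (Rmult_le_reg_l (8 * PI)); [lra|].
    replace (8 * PI * (Cmod (c N) / (16 * PI) * Cmod w ^ N))%R with
      (Cmod w ^ N * (Cmod (c N) / 2))%R by (field; lra).
    lra.
Qed.

Lemma value_lower_bound (h : C -> C) (u : C) : entire h -> ~ constant_map h ->
  exists (N : nat) (c d : R), (0 < c)%R /\ (0 < d)%R /\
  forall z, (Cmod (z - u) < d)%R -> (c * Cmod (z - u) ^ N <= Cmod (h z - h u))%R.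
Proof.
  intros Hh Hn.
  set (k := fun w => h (1 * w + u) - h u).
  assert (Hk : entire k).
  { apply (entire_minus_const (fun w => h (1 * w + u))).
    apply (entire_comp h); [exact Hh|apply entire_affine]. }
  assert (Hex : exists w, k w <> 0).
  { apply NNPP. intros HN. apply Hn. exists (h u). intros z.
    apply Ceq_minus. apply NNPP. intros H. apply HN. exists (z - u).
    unfold k. now replace (1 * (z - u) + u) with z by ring. }
  destruct Hex as [w1 Hw1].
  destruct (zero_lower_bound k w1 Hk Hw1) as [N [c [d [Hc [Hd H]]]]].
  exists N, c, d. repeat split; auto. intros z Hz. specialize (H _ Hz).
  unfold k in H. now replace (1 * (z - u) + u) with z in H by ring.
Qed.

(** * Curves and asymptotic values *)

Definition tends_to_infinity (u : R -> C) : Prop :=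
  forall M, exists T, forall t, (T <= t)%R -> (M < Cmod (u t))%R.

Definition tends_to (u : R -> C) (z : C) : Prop :=
  forall e, (0 < e)%R -> exists T, forall t, (T <= t)%R -> (Cmod (u t - z) < e)%R.

(** A curve on the half-line is extended to a constant for negative times, which
    makes it continuous on the whole line. *)
Lemma asymptotic_value_iff (f : C -> C) (z : C) :
  asymptotic_value f z <->
  exists u, continuous_path u /\ tends_to_infinity u /\ tends_to (fun t => f (u t)) z.
Proof.
  split.
  - intros [u [Hc [Hinf Hlim]]].
    exists (fun t => u (Rmax 0 t)). split; [|split].
    + intros t P HP. specialize (Hc (Rmax 0 t) (Rmax_l 0 t) P HP).
      destruct Hc as [d Hd]. exists d. intros s Hs. apply Hd; [|apply Rmax_l].
      change (Rabs (Rmax 0 s - Rmax 0 t) < d)%R.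
      change (Rabs (s - t) < d)%R in Hs.
      eapply Rle_lt_trans; [|exact Hs].
      unfold Rmax. repeat destruct Rle_dec; unfold Rabs; repeat destruct Rcase_abs; lra.
    + intros M. apply is_lim_spec in Hinf. destruct (Hinf M) as [T HT].
      exists (Rmax 0 T + 1)%R. intros t Ht.
      assert (H1 := Rmax_l 0 T). assert (H2 := Rmax_r 0 T).
      rewrite Rmax_right by lra. apply HT. lra.
    + intros e He.
      destruct (Hlim (fun y => (Cmod (y - z) < e)%R)) as [T HT].
      { apply locally_Cmod. eauto. }
      exists (Rmax 0 T + 1)%R. intros t Ht.
      assert (H1 := Rmax_l 0 T). assert (H2 := Rmax_r 0 T).
      rewrite Rmax_right by lra. apply HT. lra.
  - intros [u [Hc [Hinf Hlim]]]. exists u. split; [|split].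
    + intros t _ P HP. generalize (Hc t P HP). unfold filtermap, within.
      apply filter_imp. auto.
    + apply is_lim_spec. intros M. destruct (Hinf M) as [T HT].
      exists T. intros t Ht. apply HT. lra.
    + intros P HP. apply locally_Cmod in HP. destruct HP as [d [Hd HP]].
      destruct (Hlim d Hd) as [T HT]. exists T. intros t Ht. apply HP, HT. lra.
Qed.

(** If every point of a square had a neighbourhood that the curve eventually
    avoids, then by compactness the curve would eventually avoid the square.
    One positive number per point records both the radius and, through its
    inverse, the time. *)
Lemma accumulation_point (u : R -> C) : ~ tends_to_infinity u ->
  exists z, forall e T, (0 < e)%R -> exists t, (T <= t)%R /\ (Cmod (u t - z) < e)%R.
Proof.
  intros HN. apply not_all_ex_not in HN. destruct HN as [M HM].
  assert (Hfreq : forall T, exists t, (T <= t)%R /\ (Cmod (u t) <= M)%R).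
  { intros T. apply NNPP. intros H. apply HM. exists T. intros t Ht.
    apply Rnot_le_lt. intros Hle. apply H. now exists t. }
  apply NNPP. intros Hno.
  assert (Hd : forall x y, exists d : posreal, forall t, (/ d <= t)%R ->
    (2 * d <= Cmod (u t - (x, y)))%R).
  { intros x y. apply NNPP. intros H. apply Hno. exists (x, y). intros e T He.
    apply NNPP. intros H'. apply H.
    (* [d <= / (|T| + 1)] encodes that times beyond [/ d] are beyond [T]. *)
    set (d := Rmin (e / 2) (/ (Rabs T + 1))).
    assert (HT := Rabs_pos T).
    assert (Hd : (0 < d)%R).
    { apply Rmin_glb_lt; [lra|]. apply Rinv_0_lt_compat. lra. }
    exists (mkposreal d Hd). intros t Ht. simpl in *.
    apply Rnot_lt_le. intros Hlt. apply H'. exists t. split.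
    - apply Rle_trans with (Rabs T + 1)%R; [assert (T <= Rabs T)%R by apply Rle_abs; lra|].
      apply Rle_trans with (/ d)%R; [|exact Ht].
      rewrite <- (Rinv_inv (Rabs T + 1)). apply Rinv_le_contravar; [exact Hd|apply Rmin_r].
    - apply Rlt_le_trans with (2 * d)%R; [exact Hlt|].
      assert (d <= e / 2)%R by apply Rmin_l. lra. }
  set (delta := fun x y => proj1_sig (constructive_indefinite_description _ (Hd x y))).
  assert (Hdelta : forall x y t, (/ delta x y <= t)%R ->
    (2 * delta x y <= Cmod (u t - (x, y)))%R).
  { intros x y. exact (proj2_sig (constructive_indefinite_description _ (Hd x y))). }
  destruct (compactness_value_2d (- M) M (- M) M delta) as [d Hcov].
  destruct (Hfreq (/ d)%R) as [t [Ht HtM]].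
  apply (Hcov (fst (u t)) (snd (u t))).
  - assert (H := re_le_Cmod (u t)). apply Rabs_le_between.
    eapply Rle_trans; [exact H|exact HtM].
  - assert (H := im_le_Cmod (u t)). apply Rabs_le_between.
    eapply Rle_trans; [exact H|exact HtM].
  - intros [x [y [_ [_ [Hx [Hy Hle]]]]]].
    assert (H := Hdelta x y t).
    assert (H1 : (/ delta x y <= t)%R).
    { apply Rle_trans with (/ d)%R; [|exact Ht].
      apply Rinv_le_contravar; [apply cond_pos|exact Hle]. }
    specialize (H H1). revert H. apply Rlt_not_le.
    eapply Rle_lt_trans; [apply Cmod_le_parts|].
    simpl. unfold Rminus in *. lra.
Qed.

Lemma tends_to_image (h : C -> C) (u : R -> C) (z : C) :
  continuous h z -> tends_to u z -> tends_to (fun t => h (u t)) (h z).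
Proof.
  intros Hh Hu e He. rewrite continuous_Cmod in Hh. specialize (Hh e He).
  apply locally_Cmod in Hh. destruct Hh as [d [Hd H]].
  destruct (Hu d Hd) as [T HT]. exists T. intros t Ht. apply H, HT, Ht.
Qed.

Lemma tends_to_unique (u : R -> C) (y z : C) : tends_to u y -> tends_to u z -> y = z.
Proof.
  intros Hy Hz. apply Ceq_minus, eq_0_of_Cmod_le. intros e He.
  destruct (Hy (e / 2)%R ltac:(lra)) as [T1 H1].
  destruct (Hz (e / 2)%R ltac:(lra)) as [T2 H2].
  specialize (H1 (Rmax T1 T2) (Rmax_l _ _)). specialize (H2 (Rmax T1 T2) (Rmax_r _ _)).
  set (t := Rmax T1 T2) in *. rewrite Cmod_sym in H1.
  assert (T := Cmod_triangle (y - u t) (u t - z)).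
  replace (y - u t + (u t - z)) with (y - z) in T by ring. lra.
Qed.

Lemma continuous_modulus (u : R -> C) (t : R) :
  continuous u t -> continuous (fun s => Cmod (u s)) t.
Proof.
  intros Hu P [d Hd]. rewrite continuous_Cmod in Hu.
  generalize (Hu d (cond_pos d)). unfold filtermap. apply filter_imp. intros s Hs.
  apply Hd. change (Rabs (Cmod (u s) - Cmod (u t)) < d)%R.
  assert (L1 := Cmod_sub_lower (u s) (u t)). assert (L2 := Cmod_sub_lower (u t) (u s)).
  rewrite (Cmod_sym (u t)) in L2. apply Rabs_def1; lra.
Qed.

(** Around an accumulation point [y] of the curve, [h] stays away from [h y] on
    small circles, whereas [h] along the curve tends to [h y]; so the curve
    cannot cross these circles at late times and is trapped inside. *)
Lemma limit_dichotomy (h : C -> C) (u : R -> C) (z : C) :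
  entire h -> ~ constant_map h -> continuous_path u -> tends_to (fun t => h (u t)) z ->
  tends_to_infinity u \/ exists y, tends_to u y.
Proof.
  intros Hh Hn Hu Hz. destruct (classic (tends_to_infinity u)) as [Hi|Hi]; [now left|right].
  destruct (accumulation_point u Hi) as [y Hy]. exists y.
  assert (Ezy : h y = z).
  { apply Ceq_minus, eq_0_of_Cmod_le. intros e He.
    destruct (Hz (e / 2)%R ltac:(lra)) as [T HT].
    assert (Ch := entire_continuous h Hh y). rewrite continuous_Cmod in Ch.
    specialize (Ch (e / 2)%R ltac:(lra)). apply locally_Cmod in Ch. destruct Ch as [d [Hd H]].
    destruct (Hy d T Hd) as [t [Ht Hty]]. specialize (HT t Ht). specialize (H _ Hty).
    rewrite Cmod_sym in H.
    assert (Tr := Cmod_triangle (h y - h (u t)) (h (u t) - z)).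
    replace (h y - h (u t) + (h (u t) - z)) with (h y - z) in Tr by ring. lra. }
  destruct (value_lower_bound h y Hh Hn) as [N [c [d [Hc [Hd Hlow]]]]].
  intros e He. set (rho := (Rmin e d / 2)%R).
  assert (Hm : (0 < Rmin e d)%R) by now apply Rmin_glb_lt.
  assert (M1 := Rmin_l e d). assert (M2 := Rmin_r e d).
  assert (Hrho : (0 < rho < e)%R /\ (rho < d)%R) by (unfold rho; lra).
  assert (Hpos : (0 < c * rho ^ N)%R).
  { apply Rmult_lt_0_compat; [exact Hc|]. apply pow_lt. lra. }
  destruct (Hz _ Hpos) as [T HT]. destruct (Hy rho T ltac:(lra)) as [t1 [Ht1 Hty1]].
  exists t1. intros t2 Ht2. apply Rlt_trans with rho; [|lra].
  apply Rnot_le_lt. intros Hle.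
  destruct (IVT_gen (fun t => Cmod (u t - y)) t1 t2 rho) as [t3 [Ht3 E]].
  - intros t. apply continuity_pt_filterlim.
    apply (continuous_modulus (fun t => u t - y)).
    apply continuous_Cminus; [apply Hu|apply continuous_const].
  - rewrite Rmin_left, Rmax_right; lra.
  - rewrite Rmin_left, Rmax_right in Ht3 by lra.
    specialize (Hlow (u t3) ltac:(lra)). rewrite E, Ezy in Hlow.
    specialize (HT t3 ltac:(lra)). lra.
Qed.

Lemma dense_range_not_constant (h : C -> C) : dense_range h -> ~ constant_map h.
Proof.
  intros H [c Hc]. destruct (H (c + 1) 1%R ltac:(lra)) as [z Hz].
  rewrite Hc in Hz. replace (c - (c + 1)) with (- (1)) in Hz by ring.
  rewrite Cmod_opp, Cmod_1 in Hz. lra.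
Qed.

(** * Iterates and dense ranges *)

Lemma dense_range_iter (f : C -> C) (n : nat) : entire f -> ~ constant_map f ->
  dense_range (Nat.iter n f).
Proof.
  intros Hf Hn. induction n as [|n IH]; intros w e He.
  - exists w. simpl. replace (w - w) with (RtoC 0) by ring. now rewrite Cmod_0.
  - destruct (entire_dense_range f Hf Hn w (e / 2)%R ltac:(lra)) as [y Hy].
    assert (Cf := entire_continuous f Hf y). rewrite continuous_Cmod in Cf.
    specialize (Cf (e / 2)%R ltac:(lra)). apply locally_Cmod in Cf. destruct Cf as [d [Hd H]].
    destruct (IH y d Hd) as [z Hz]. exists z. simpl. specialize (H _ Hz).
    assert (Tr := Cmod_triangle (f (Nat.iter n f z) - f y) (f y - w)).
    replace (f (Nat.iter n f z) - f y + (f y - w)) with (f (Nat.iter n f z) - w) in Tr by ring.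
    lra.
Qed.

(** Replaces the identity theorem: density of the range suffices. *)
Lemma eq_on_dense_range (h k v : C -> C) : continuous_map h -> continuous_map k -> dense_range v ->
  (forall x, h (v x) = k (v x)) -> forall z, h z = k z.
Proof.
  intros Hh Hk Hv E z. apply Ceq_minus, eq_0_of_Cmod_le. intros e He.
  assert (C : continuous (fun y => h y - k y) z) by now apply continuous_Cminus.
  rewrite continuous_Cmod in C. specialize (C e He). apply locally_Cmod in C.
  destruct C as [d [Hd H]]. destruct (Hv z d Hd) as [x Hx]. specialize (H _ Hx).
  rewrite E in H. replace (k (v x) - k (v x) - (h z - k z)) with (- (h z - k z)) in H by ring.
  rewrite Cmod_opp in H. lra.
Qed.

Lemma transcendental_not_constant (f : C -> C) : transcendental_entire f -> ~ constant_map f.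
Proof.
  intros [_ Hp] [c Hc]. apply Hp. exists O, (fun _ => c). intros z.
  rewrite sum_O, Hc. simpl. now rewrite Cmult_1_r.
Qed.

(** * Forward orbits of singular values *)

Definition singular_orbit (f : C -> C) (z : C) : Prop :=
  exists (n : nat) (s : C), singular_value f s /\ z = Nat.iter n f s.

Lemma singular_orbit_step (f : C -> C) (z : C) : singular_orbit f z -> singular_orbit f (f z).
Proof. intros [n [s [Hs ->]]]. exists (S n), s. now split. Qed.

Lemma singular_orbit_iter (f : C -> C) (n : nat) (z : C) :
  singular_orbit f z -> singular_orbit f (Nat.iter n f z).
Proof. intros H. induction n as [|n IH]; [exact H|]. exact (singular_orbit_step f _ IH). Qed.

Lemma singular_value_orbit (f : C -> C) (s : C) : singular_value f s -> singular_orbit f s.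
Proof. intros H. now exists O, s. Qed.

(** By the chain rule, one of the points [w], [f w], ..., [f^(n-1) w] is critical
    for [f]. *)
Lemma critical_value_iter (f : C -> C) (n : nat) (w : C) : entire f ->
  is_Cderive (Nat.iter n f) w 0 -> singular_orbit f (Nat.iter n f w).
Proof.
  intros Hf. induction n as [|n IH]; intros H.
  - exfalso. assert (E := is_Cderive_unique _ _ _ _ H (is_Cderive_id w)).
    symmetry in E. now apply C1_nz.
  - destruct (proj1 (entire_Cderive f) Hf (Nat.iter n f w)) as [l Hl].
    destruct (proj1 (entire_Cderive _) (entire_iter f n Hf) w) as [m Hm].
    assert (E := is_Cderive_unique _ _ _ _ H (is_Cderive_comp f (Nat.iter n f) w l m Hl Hm)).
    destruct (Ceq_dec l 0) as [->|nl].
    + apply singular_value_orbit. left. exists (Nat.iter n f w).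
      split; [now apply is_derive_Cderive|reflexivity].
    + apply (singular_orbit_step f), IH.
      destruct (Ceq_dec m 0) as [->|nm]; [exact Hm|].
      exfalso. symmetry in E. revert E. now apply Cmult_neq_0.
Qed.

(** Stated for the curve itself, since the induction replaces [u] by its image
    under [f] as long as that image tends to infinity. *)
Lemma asymptotic_value_iter (f : C -> C) (n : nat) (u : R -> C) (z : C) :
  entire f -> ~ constant_map f -> continuous_path u -> tends_to_infinity u ->
  tends_to (fun t => Nat.iter n f (u t)) z -> singular_orbit f z.
Proof.
  intros Hf Hn. revert u. induction n as [|n IH]; intros u Hu Hi Hz.
  - exfalso. destruct (Hz 1%R ltac:(lra)) as [T1 H1]. destruct (Hi (Cmod z + 1)%R) as [T2 H2].
    specialize (H1 (Rmax T1 T2) (Rmax_l _ _)). specialize (H2 (Rmax T1 T2) (Rmax_r _ _)).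
    simpl in H1. assert (L := Cmod_sub_lower (u (Rmax T1 T2)) z). lra.
  - assert (Cv : continuous_path (fun t => f (u t))).
    { intros t. apply (continuous_comp u f); [apply Hu|now apply entire_continuous]. }
    assert (Hz' : tends_to (fun t => Nat.iter n f (f (u t))) z).
    { intros e He. destruct (Hz e He) as [T HT]. exists T. intros t Ht.
      rewrite <- Nat.iter_succ_r. now apply HT. }
    destruct (limit_dichotomy (Nat.iter n f) (fun t => f (u t)) z) as [Hinf|[y Hy]]; auto.
    + now apply entire_iter.
    + now apply dense_range_not_constant, dense_range_iter.
    + now apply (IH (fun t => f (u t))).
    + assert (E : z = Nat.iter n f y).
      { apply (tends_to_unique _ _ _ Hz').
        apply (tends_to_image (Nat.iter n f) (fun t => f (u t))); [|exact Hy].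
        now apply entire_continuous, entire_iter. }
      rewrite E. apply singular_orbit_iter, singular_value_orbit. right.
      apply asymptotic_value_iff. now exists u.
Qed.

Lemma affine_tends_to (a b z : C) (u : R -> C) : tends_to u z ->
  tends_to (fun t => a * u t + b) (a * z + b).
Proof.
  apply (tends_to_image (fun y => a * y + b)), entire_continuous, entire_affine.
Qed.

(** * Singular values under an affine symmetry *)

Lemma iter_affine_comm (f : C -> C) (a b : C) (n : nat) (z : C) :
  (forall z, f (a * z + b) = a * f z + b) ->
  Nat.iter n f (a * z + b) = a * Nat.iter n f z + b.
Proof.
  intros Hcomm. induction n as [|n IH]; [reflexivity|]. simpl. now rewrite IH, Hcomm.
Qed.

Lemma singular_value_affine (f : C -> C) (a b s : C) : entire f -> a <> 0 ->
  (forall z, f (a * z + b) = a * f z + b) ->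
  singular_value f s -> singular_value f (a * s + b).
Proof.
  intros Hf Ha Hcomm [[w [Hw ->]]|Hs].
  - left. exists (a * w + b). split; [|now rewrite Hcomm].
    apply is_derive_Cderive in Hw. apply is_derive_Cderive.
    destruct (proj1 (entire_Cderive f) Hf (a * w + b)) as [l Hl].
    (* Differentiating both sides of the commutation relation at [w]. *)
    assert (H1 : is_Cderive (fun z => f (a * z + b)) w (l * (a * 1 + 0))).
    { apply (is_Cderive_comp f (fun z => a * z + b)); [exact Hl|].
      apply (is_Cderive_plus (fun z => a * z) (fun _ => b)); [|apply is_Cderive_const].
      apply is_Cderive_scal, is_Cderive_id. }
    assert (H2 : is_Cderive (fun z => f (a * z + b)) w (a * 0 + 0)).
    { apply (is_Cderive_ext (fun z => a * f z + b)); [intros y; now rewrite Hcomm|].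
      apply (is_Cderive_plus (fun z => a * f z) (fun _ => b));
        [now apply is_Cderive_scal|apply is_Cderive_const]. }
    assert (E := is_Cderive_unique _ _ _ _ H1 H2).
    replace (RtoC 0) with l; [exact Hl|].
    replace l with (l * (a * 1 + 0) / a) by (field; exact Ha). rewrite E. field. exact Ha.
  - right. apply asymptotic_value_iff in Hs. destruct Hs as [u [Hu [Hi Hs]]].
    apply asymptotic_value_iff. exists (fun t => a * u t + b). split; [|split].
    + intros t. apply (continuous_comp u (fun z => a * z + b)); [apply Hu|].
      apply entire_continuous, entire_affine.
    + intros M. assert (Pa : (0 < Cmod a)%R) by now apply Cmod_gt_0.
      destruct (Hi ((M + Cmod b) / Cmod a)%R) as [T HT]. exists T. intros t Ht.
      specialize (HT t Ht).
      assert (L := Cmod_sub_lower (a * u t) (- b)).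
      replace (a * u t - - b) with (a * u t + b) in L by ring.
      rewrite Cmod_opp, Cmod_mult in L.
      apply (Rmult_lt_compat_l (Cmod a)) in HT; [|exact Pa].
      replace (Cmod a * ((M + Cmod b) / Cmod a))%R with (M + Cmod b)%R in HT by (field; lra).
      lra.
    + intros e He. destruct (affine_tends_to a b _ _ Hs e He) as [T HT].
      exists T. intros t Ht. rewrite Hcomm. now apply HT.
Qed.

Lemma singular_orbit_affine (f : C -> C) (a b z : C) : entire f -> a <> 0 ->
  (forall z, f (a * z + b) = a * f z + b) ->
  singular_orbit f z -> singular_orbit f (a * z + b).
Proof.
  intros Hf Ha Hcomm [n [s [Hs ->]]]. exists n, (a * s + b).
  split; [now apply singular_value_affine|].
  now rewrite iter_affine_comm.
Qed.

(** The affine map only moves the singular values of the iterate, and the orbits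
    of singular values are invariant under it. *)
Lemma singular_value_affine_iter (f : C -> C) (a b : C) (n : nat) (s : C) :
  entire f -> ~ constant_map f -> a <> 0 ->
  (forall z, f (a * z + b) = a * f z + b) ->
  singular_value (fun z => a * Nat.iter n f z + b) s -> singular_orbit f s.
Proof.
  intros Hf Hn Ha Hcomm [[w [Hw ->]]|Hs].
  - apply singular_orbit_affine; auto. apply critical_value_iter; [exact Hf|].
    apply is_derive_Cderive in Hw.
    destruct (proj1 (entire_Cderive _) (entire_iter f n Hf) w) as [m Hm].
    assert (E : a * m + 0 = 0).
    { refine (is_Cderive_unique _ _ _ _ _ Hw).
      apply (is_Cderive_plus (fun z => a * Nat.iter n f z) (fun _ => b));
        [now apply is_Cderive_scal|apply is_Cderive_const]. }
    destruct (Ceq_dec m 0) as [->|nm]; [exact Hm|]. exfalso.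
    rewrite Cplus_0_r in E. revert E. now apply Cmult_neq_0.
  - apply asymptotic_value_iff in Hs. destruct Hs as [u [Hu [Hi Hs]]].
    replace s with (a * ((s - b) / a) + b) by (field; exact Ha).
    apply singular_orbit_affine; auto.
    apply (asymptotic_value_iter f n u); auto.
    replace ((s - b) / a) with (/ a * s + - b / a) by (field; exact Ha).
    intros e He. destruct (affine_tends_to (/ a) (- b / a) _ _ Hs e He) as [T HT].
    exists T. intros t Ht. specialize (HT t Ht).
    replace (/ a * (a * Nat.iter n f (u t) + b) + - b / a) with (Nat.iter n f (u t)) in HT
      by (field; exact Ha).
    exact HT.
Qed.

(** * Postsingular finiteness from a finite invariant set *)

Lemma finite_set_closed (A : C -> Prop) (z : C) : finite_set A -> closure A z -> A z.
Proof.
  intros [l Hl] Hz.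
  assert (Hd : exists d, (0 < d)%R /\ forall w, In w l -> w <> z -> (d <= Cmod (w - z))%R).
  { clear Hl. induction l as [|x l [d [Hd IH]]].
    - exists 1%R. split; [lra|]. intros w [].
    - destruct (Ceq_dec x z) as [->|n].
      + exists d. split; [exact Hd|]. intros w [->|Hw] Hwz; [easy|auto].
      + exists (Rmin d (Cmod (x - z))). split.
        * apply Rmin_glb_lt; [exact Hd|]. now apply Cmod_gt_0, Cminus_eq_contra.
        * intros w [<-|Hw] Hwz; [apply Rmin_r|].
          eapply Rle_trans; [apply Rmin_l|auto]. }
  destruct Hd as [d [Hd H]].
  destruct (Hz (fun w => (Cmod (w - z) < d)%R)) as [w [Hw Sw]].
  { apply locally_Cmod. eauto. }
  destruct (Ceq_dec w z) as [<-|n]; [exact Sw|].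
  specialize (H w (Hl w Sw) n). lra.
Qed.

Lemma closure_mono (A B : C -> Prop) (z : C) :
  (forall w, A w -> B w) -> closure A z -> closure B z.
Proof. intros H Hz U HU. destruct (Hz U HU) as [w [Uw Sw]]. exists w. auto. Qed.

Lemma limit_point_closure (A : C -> Prop) (z : C) : limit_point A z -> closure A z.
Proof. intros Hz U HU. destruct (Hz U HU) as [w [Uw [_ Sw]]]. now exists w. Qed.

Lemma closure_incl (A : C -> Prop) (z : C) : A z -> closure A z.
Proof. intros Hz U HU. exists z. split; [now apply locally_singleton|exact Hz]. Qed.

(** A finite set is closed, so it absorbs both the limit points in the definition
    of the singular set and the closure in that of the postsingular set. *)
Lemma postsingularly_finite_of_invariant (k : C -> C) (A : C -> Prop) :
  finite_set A -> (forall s, singular_value k s -> A s) -> (forall z, A z -> A (k z)) ->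
  postsingularly_finite k.
Proof.
  intros Hfin Hsing Hinv. destruct (Hfin) as [l Hl]. exists l. intros z Hz.
  apply Hl, finite_set_closed; [exact Hfin|].
  revert Hz. apply closure_mono. intros w [n [s [Hs ->]]].
  induction n as [|n IH]; [|now apply Hinv].
  destruct Hs as [Hs|Hs]; [now apply Hsing|].
  apply finite_set_closed; [exact Hfin|].
  apply limit_point_closure in Hs. revert Hs. now apply closure_mono.
Qed.

Lemma singular_orbit_finite (f : C -> C) :
  postsingularly_finite f -> finite_set (singular_orbit f).
Proof.
  intros [l Hl]. exists l. intros z [n [s [Hs ->]]].
  apply Hl, closure_incl. exists n, s. split; [now left|reflexivity].
Qed.

Lemma postsingularly_finite_affine_iter (f : C -> C) (a b : C) (n : nat) :
  entire f -> ~ constant_map f -> a <> 0 ->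
  (forall z, f (a * z + b) = a * f z + b) -> postsingularly_finite f ->
  postsingularly_finite (fun z => a * Nat.iter n f z + b).
Proof.
  intros Hf Hn Ha Hcomm Hfin.
  apply (postsingularly_finite_of_invariant _ (singular_orbit f)).
  - now apply singular_orbit_finite.
  - intros s Hs. now apply (singular_value_affine_iter f a b n).
  - intros z Hz. apply (singular_orbit_affine f a b); auto. now apply singular_orbit_iter.
Qed.

Theorem theorem3p4 (f g : C -> C) (a b : C) (p : nat)
  (hf : transcendental_entire f)
  (hg : transcendental_entire g)
  (hcomm : forall z : C, f (g z) = g (f z))
  (hfB : class_B f)
  (hp : (1 <= p)%nat)
  (ha0 : a <> 0)
  (ha1 : a <> 1)
  (ha : Cmod a = 1%R)
  (hgf : forall z : C, g z = a * Nat.iter p f z + b)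
  (hpsf : postsingularly_finite f) :
  postsingularly_finite g /\ postsingularly_finite (fun z : C => f (g z)).
Proof.
  assert (Hf : entire f) by apply hf.
  assert (Hn := transcendental_not_constant f hf).
  assert (Hc : forall z, f (a * z + b) = a * f z + b).
  { apply (eq_on_dense_range (fun z => f (a * z + b)) (fun z => a * f z + b) (Nat.iter p f)).
    - apply entire_continuous, (entire_comp f (fun z => a * z + b)); [exact Hf|apply entire_affine].
    - apply entire_continuous, (entire_comp (fun z => a * z + b) f); [apply entire_affine|exact Hf].
    - now apply dense_range_iter.
    - intros x. rewrite <- hgf, hcomm, hgf, <- Nat.iter_succ_r. reflexivity. }
  split.
  - replace g with (fun z => a * Nat.iter p f z + b).
    + now apply postsingularly_finite_affine_iter.
    + apply functional_extensionality. intros z. now rewrite hgf.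
  - replace (fun z => f (g z)) with (fun z => a * Nat.iter (S p) f z + b).
    + now apply postsingularly_finite_affine_iter.
    + apply functional_extensionality. intros z. now rewrite hgf, Hc.
Qed.
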